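(* Let $f,g$ be convergent power series in $(x,y)$ starting with terms of order at least two, and let $v$ be the analytic vector field $$\frac{dx}{dt}=y+f(x,y),\qquad \frac{dy}{dt}=g(x,y).$$ Then $v$ is linearizable by convergent transformations if and only if it is formally linearizable.
   Context: Power series have coefficients in $\mathbb K=\mathbb R$ or $\mathbb C$ (the same $\mathbb K$ throughout). A transformation is an invertible change of coordinates near the origin fixing the origin, given by power series in $(x,y)$; it is formal or convergent according to whether the power series are formal or converge near the origin. The vector field $v$ is formally linearizable (respectively, linearizable by convergent transformations) if some formal (respectively, convergent) transformation transforms $v$ into a linear vector field. *)

(* Defs.v *)
From mathcomp Require Import all_boot all_order all_algebra.
From mathcomp Require Import all_classical all_reals.
From mathcomp Require Import topology normedtype sequences.
From mathcomp.real_closed Require Export complex.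

Set Implicit Arguments.
Unset Strict Implicit.
Unset Printing Implicit Defensive.

Import Order.TTheory GRing.Theory Num.Theory.
Import numFieldNormedType.Exports.
Local Open Scope ring_scope.

(* [f i j] is the coefficient of x^i y^j.  Equality of power series is
   pointwise equality [=2] of the coefficient functions. *)
Definition fps2 (K : Type) : Type := nat -> nat -> K.

Section PowerSeries.
Variable K : numFieldType.
Implicit Types f g p q : fps2 K.

Definition fps_one : fps2 K := fun i j => ((i == 0%N) && (j == 0%N))%:R.
Definition fps_x : fps2 K := fun i j => ((i == 1%N) && (j == 0%N))%:R.
Definition fps_y : fps2 K := fun i j => ((i == 0%N) && (j == 1%N))%:R.

Definition fps_add f g : fps2 K := fun i j => f i j + g i j.

Definition fps_mul f g : fps2 K := fun i j =>
  \sum_(k < i.+1) \sum_(l < j.+1) f k l * g (i - k)%N (j - l)%N.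

Definition fps_exp f n : fps2 K := iter n (fps_mul f) fps_one.

Definition fps_dx f : fps2 K := fun i j => f i.+1 j *+ i.+1.
Definition fps_dy f : fps2 K := fun i j => f i j.+1 *+ j.+1.

(* f(p(x,y), q(x,y)).  Only meaningful when p and q have no constant term:
   then p^k q^l has no term of degree < k + l, so the coefficient of x^i y^j
   of the composite only involves the indices k, l <= i + j. *)
Definition fps_comp f p q : fps2 K := fun i j =>
  \sum_(k < (i + j).+1) \sum_(l < (i + j).+1)
    f k l * fps_mul (fps_exp p k) (fps_exp q l) i j.

Definition order_ge (n : nat) f : Prop :=
  forall i j, (i + j < n)%N -> f i j = 0.

(* Absolute convergence of the double series at all points of a bidisc
   (bisquare if K is real) around the origin; the nonnegative terms are
   grouped by total degree. *)
Definition convergent f : Prop :=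
  exists2 r : K, 0 < r &
    forall x y : K, `|x| < r -> `|y| < r ->
      cvgn (series (fun n : nat =>
        \sum_(i < n.+1) `|f i (n - i)%N * x ^+ i * y ^+ (n - i)|)).

Definition formal f : Prop := True.

Definition linear_form f : Prop := forall i j, (i + j)%N != 1%N -> f i j = 0.

(* A pair of power series, seen either as a map (x,y) |-> (P.1, P.2) or as a
   vector field dx/dt = V.1, dy/dt = V.2. *)
Definition fps_pair : Type := (fps2 K * fps2 K)%type.
Implicit Types P Q V W : fps_pair.

Definition pair_eq P Q : Prop := P.1 =2 Q.1 /\ P.2 =2 Q.2.

Definition id_map : fps_pair := (fps_x, fps_y).

Definition map_comp P Q : fps_pair :=
  (fps_comp P.1 Q.1 Q.2, fps_comp P.2 Q.1 Q.2).

Definition fixes_origin P : Prop := P.1 0%N 0%N = 0 /\ P.2 0%N 0%N = 0.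

Definition in_class (C : fps2 K -> Prop) P : Prop := C P.1 /\ C P.2.

(* [C] is [formal] or [convergent]; the inverse is required to be of the same
   class. *)
Definition transformation (C : fps2 K -> Prop) P : Prop :=
  [/\ fixes_origin P, in_class C P &
    exists Q, [/\ fixes_origin Q, in_class C Q,
      pair_eq (map_comp P Q) id_map & pair_eq (map_comp Q P) id_map]].

(* The derivative of [p] along [V]. *)
Definition lie_derivative V p : fps2 K :=
  fps_add (fps_mul (fps_dx p) V.1) (fps_mul (fps_dy p) V.2).

(* In the new coordinates (X, Y) = (P.1 (x,y), P.2 (x,y)), the vector field V
   reads dX/dt = W.1 (X,Y), dY/dt = W.2 (X,Y), i.e. DP . V = W o P. *)
Definition transforms P V W : Prop :=
  pair_eq (lie_derivative V P.1, lie_derivative V P.2) (map_comp W P).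

Definition linear_field W : Prop := linear_form W.1 /\ linear_form W.2.

Definition linearizable (C : fps2 K -> Prop) V : Prop :=
  exists P W, [/\ transformation C P, linear_field W & transforms P V W].

End PowerSeries.

Arguments formal {K} f.
Arguments convergent {K} f.
Arguments fps_x {K}.
Arguments fps_y {K}.

(* Main.v *)
From HB Require Import structures.
Require Import Defs.
From mathcomp Require Import all_boot all_order all_algebra.
From mathcomp Require Import all_classical all_reals.
From mathcomp Require Import topology normedtype sequences.
From mathcomp Require Import ring.

(** Why the theorem holds.  Put p = y + f, so that v = p d/dx + g d/dy, and
    suppose that v is formally linearizable.  One of the two linearizing
    coordinates, X, has a nonzero x-coefficient, and the linear normal form,
    being nilpotent, gives v(v(X)) = 0 ([nilpotent_coordinate]).  Then
    Y = v(X) is a formal first integral with dY/dy a unit, so that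
    p Y_x + g Y_y = 0 forces g = p h; hence v = p w with w = d/dx + h d/dy.
    Moreover Y = p w(X) with w(X) a unit, and w(Y) = 0 forces w(p) = p k
    ([formal_factorization]): the curve of zeros of v is invariant under w.

    The two divisibilities are the only obstruction, and the quotients h and
    k are unique, hence convergent: p is regular in y of order one, and
    division by p is a recursion on the total degree that preserves geometric
    bounds ([quotient_bounded]).  Conversely, given h and k, new coordinates
    are found without any divergent choice.  Solve the Cauchy problems
      w(U) = - k U,  U(0,y) = 1,      and      w(X) = U,  X(0,y) = 0,
    by the linear Cauchy-Kovalevskaya theorem ([transport_bounded]) and set
    Y = p U.  Then v(X) = p U = Y and
    v(Y) = p (w(p) U + p w(U)) = p (p k U - p k U) = 0, so that (X, Y) carries
    v to Y d/dX ([convergent_coordinates]).  Since (X, Y) is tangent to the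
    identity, the analytic inverse function theorem ([inverse_map]) makes it
    a convergent transformation.

    Convergence is handled throughout in the form
    |f_ij| <= M rho^(i+j) ([geom_bounded]), which is an estimate over any
    numeric field; completeness of the real numbers enters only in passing
    from this bound back to the convergence of the double series. *)

Set Implicit Arguments.
Unset Strict Implicit.
Unset Printing Implicit Defensive.
Import Order.TTheory GRing.Theory Num.Theory.
Import numFieldNormedType.Exports.
Local Open Scope ring_scope.

(** * The ring of power series in two variables *)
HB.instance Definition _ (K : numFieldType) :=
  Choice.copy (fps2 K) (nat -> nat -> K).

Section Ring.
Variable K : numFieldType.
Implicit Types f g h : fps2 K.

Definition fps_zero : fps2 K := fun _ _ => 0.
Definition fps_opp f : fps2 K := fun i j => - f i j.

Lemma fps_ext f g : (forall i j, f i j = g i j) -> f = g.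
Proof. by move=> fg; apply/funext => i; apply/funext => j. Qed.

(** Low-order coefficients of a product of series are those of a product of
    polynomials in x over the polynomials in y.  Associativity and
    commutativity of the product, and below the Leibniz rule, are inherited
    from polynomials in this way. *)
Definition trunc (n : nat) f : {poly {poly K}} :=
  \poly_(i < n) \poly_(j < n) f i j.

Lemma coef_trunc n f i j : (i < n)%N -> (j < n)%N -> (trunc n f)`_i`_j = f i j.
Proof. by move=> lin ljn; rewrite /trunc coef_poly lin coef_poly ljn. Qed.

Lemma fps_mulE f g (P Q : {poly {poly K}}) i j :
    (forall k l, (k <= i)%N -> (l <= j)%N -> P`_k`_l = f k l) ->
    (forall k l, (k <= i)%N -> (l <= j)%N -> Q`_k`_l = g k l) ->
  fps_mul f g i j = (P * Q)`_i`_j.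
Proof.
move=> Pf Qg; rewrite coefM coef_sum; apply: eq_bigr => k _.
rewrite coefM; apply: eq_bigr => l _.
by rewrite Pf -1?ltnS // Qg ?leq_subr.
Qed.

Lemma fps_mul_trunc n f g i j : (i < n)%N -> (j < n)%N ->
  fps_mul f g i j = (trunc n f * trunc n g)`_i`_j.
Proof.
by move=> lin ljn; apply: fps_mulE => k l ki lj; rewrite coef_trunc //;
  [exact: leq_ltn_trans lin|exact: leq_ltn_trans ljn|
   exact: leq_ltn_trans lin|exact: leq_ltn_trans ljn].
Qed.

Lemma fps_addA : associative (@fps_add K).
Proof. by move=> f g h; apply: fps_ext => i j; apply: addrA. Qed.
Lemma fps_addC : commutative (@fps_add K).
Proof. by move=> f g; apply: fps_ext => i j; apply: addrC. Qed.
Lemma fps_add0 : left_id fps_zero (@fps_add K).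
Proof. by move=> f; apply: fps_ext => i j; apply: add0r. Qed.
Lemma fps_addN : left_inverse fps_zero fps_opp (@fps_add K).
Proof. by move=> f; apply: fps_ext => i j; apply: addNr. Qed.

HB.instance Definition _ :=
  GRing.isZmodule.Build (fps2 K) fps_addA fps_addC fps_add0 fps_addN.

Lemma fps_mulA : associative (@fps_mul K).
Proof.
move=> f g h; apply: fps_ext => i j.
pose n := (maxn i j).+1.
have bnd k l : (k <= i)%N -> (l <= j)%N -> ((k < n)%N * (l < n)%N)%type.
  by move=> ki lj; split; rewrite ltnS leq_max ?ki ?lj ?orbT.
rewrite (fps_mulE (P := trunc n f) (Q := trunc n g * trunc n h)); last first.
- by move=> k l ki lj; rewrite (@fps_mul_trunc n) //; case: (bnd _ _ ki lj).
- by move=> k l ki lj; rewrite coef_trunc //; case: (bnd _ _ ki lj).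
rewrite mulrA; apply/esym/fps_mulE.
- by move=> k l ki lj; rewrite (@fps_mul_trunc n) //; case: (bnd _ _ ki lj).
- by move=> k l ki lj; rewrite coef_trunc //; case: (bnd _ _ ki lj).
Qed.

Lemma fps_mulC : commutative (@fps_mul K).
Proof.
move=> f g; apply: fps_ext => i j; pose n := (maxn i j).+1.
have lin : (i < n)%N by rewrite ltnS leq_maxl.
have ljn : (j < n)%N by rewrite ltnS leq_maxr.
by rewrite !(@fps_mul_trunc n) // mulrC.
Qed.

Lemma fps_mul1 : left_id (@fps_one K) (@fps_mul K).
Proof.
move=> f; apply: fps_ext => i j; rewrite /fps_mul big_ord_recl /=.
rewrite big_ord_recl /= /fps_one /= mul1r !subn0 big1 => [|l _].
  rewrite big1 ?addr0// => k _; rewrite big1// => l _.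
  by rewrite mul0r.
by rewrite mul0r.
Qed.

Lemma fps_mulDl : left_distributive (@fps_mul K) (@fps_add K).
Proof.
move=> f g h; apply: fps_ext => i j; rewrite /fps_mul /fps_add -big_split /=.
apply: eq_bigr => k _; rewrite -big_split /=.
by apply: eq_bigr => l _; rewrite mulrDl.
Qed.

Lemma fps_one_neq0 : (@fps_one K : fps2 K) != 0.
Proof.
apply/eqP => /(congr1 (fun f : fps2 K => f 0%N 0%N)); rewrite /fps_one /=.
exact/eqP/oner_neq0.
Qed.

HB.instance Definition _ :=
  GRing.Zmodule_isComNzRing.Build (fps2 K)
    fps_mulA fps_mulC fps_mul1 fps_mulDl fps_one_neq0.


Lemma fps_expE f n : fps_exp f n = f ^+ n.
Proof. by elim: n => [|n IH] //; rewrite exprS -IH. Qed.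
End Ring.

(** * Order of vanishing *)
Section Order.
Variable K : numFieldType.
Implicit Types f g h p q : fps2 K.

Lemma fpsD f g i j : (f + g) i j = f i j + g i j. Proof. by []. Qed.
Lemma fpsN f i j : (- f) i j = - f i j. Proof. by []. Qed.
Lemma fpsB f g i j : (f - g) i j = f i j - g i j. Proof. by []. Qed.

Lemma fps_sum (I : Type) (r : seq I) (P : pred I) (F : I -> fps2 K) i j :
  (\sum_(k <- r | P k) F k) i j = \sum_(k <- r | P k) F k i j.
Proof. by elim/big_rec2: _ => // k x y _ <-. Qed.

Lemma fps_coefM f g i j :
  (f * g) i j =
  \sum_(k < i.+1) \sum_(l < j.+1) f k l * g (i - k)%N (j - l)%N.
Proof. by []. Qed.

Lemma fps_coefM00 f g : (f * g) 0%N 0%N = f 0%N 0%N * g 0%N 0%N.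
Proof. by rewrite fps_coefM !big_ord1. Qed.

Lemma order_ge_leq m n f : (m <= n)%N -> order_ge n f -> order_ge m f.
Proof. by move=> mn fn i j ij; apply: fn; apply: leq_trans mn. Qed.

Lemma order_geD n f g : order_ge n f -> order_ge n g -> order_ge n (f + g).
Proof. by move=> fn gn i j ij; rewrite fpsD fn // gn // addr0. Qed.

Lemma order_geN n f : order_ge n f -> order_ge n (- f).
Proof. by move=> fn i j ij; rewrite fpsN fn // oppr0. Qed.

Lemma order_geB n f g : order_ge n f -> order_ge n g -> order_ge n (f - g).
Proof. by move=> fn gn; apply: order_geD => //; apply: order_geN. Qed.

Lemma order_ge_sum n (I : Type) (r : seq I) (P : pred I) (F : I -> fps2 K) :
  (forall k, P k -> order_ge n (F k)) ->
  order_ge n (\sum_(k <- r | P k) F k).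
Proof. by move=> Fn; apply: big_ind => //; apply: order_geD. Qed.

Lemma order_geM m n f g :
  order_ge m f -> order_ge n g -> order_ge (m + n) (f * g).
Proof.
move=> fm gn i j ij; rewrite fps_coefM big1 // => k _; rewrite big1 // => l _.
have [klm|mkl] := ltnP (k + l) m; first by rewrite fm // mul0r.
rewrite gn ?mulr0 //; rewrite -(ltn_add2l (k + l)) addnACA.
rewrite !subnKC -1?ltnS //; apply: leq_trans ij _.
by rewrite leq_add2r.
Qed.

Lemma order_geMl n f g : order_ge n g -> order_ge n (f * g).
Proof. by move=> gn; rewrite -[n]add0n; apply: order_geM. Qed.

Lemma order_geX k f : order_ge 1 f -> order_ge k (f ^+ k).
Proof.
move=> f1; elim: k => // k IH; rewrite exprS -add1n; exact: order_geM.
Qed.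

Lemma order_ge1 f : f 0%N 0%N = 0 -> order_ge 1 f.
Proof. by move=> f0 [|i] [|j]. Qed.

Lemma order_ge_mon k l p q :
  order_ge 1 p -> order_ge 1 q -> order_ge (k + l) (p ^+ k * q ^+ l).
Proof. by move=> p1 q1; apply: order_geM; apply: order_geX. Qed.

Lemma order_ge_inf f : (forall n, order_ge n f) -> f = 0.
Proof. by move=> fn; apply: fps_ext => i j; rewrite (fn (i + j).+1). Qed.

Lemma eq_order f g : (forall n, order_ge n (f - g)) -> f = g.
Proof. by move=> fg; apply/eqP; rewrite -subr_eq0; apply/eqP/order_ge_inf. Qed.

Lemma order_ge_sub_trans n f g h :
  order_ge n (f - g) -> order_ge n (g - h) -> order_ge n (f - h).
Proof.
by move=> fg gh; rewrite -[f](subrK g) -addrA; apply: order_geD.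
Qed.

Lemma order_ge_subC n f g : order_ge n (f - g) -> order_ge n (g - f).
Proof. by move=> /order_geN; rewrite opprB. Qed.

(** Completeness of the ring of power series for the topology given by the
    order of vanishing. *)
Lemma fps_limit (s : nat -> fps2 K) :
    (forall n, order_ge n.+1 (s n.+1 - s n)) ->
  exists L : fps2 K, forall n, order_ge n.+1 (L - s n).
Proof.
move=> s_cauchy.
have stable n m i j : (i + j <= n)%N -> s (n + m)%N i j = s n i j.
  move=> ijn; elim: m => [|m IH]; first by rewrite addn0.
  rewrite addnS -IH; apply/eqP; rewrite -subr_eq0 -fpsB s_cauchy //.
  by rewrite ltnS (leq_trans ijn) // leq_addr.
exists (fun i j => s (i + j)%N i j) => n i j; rewrite ltnS => ijn.
by rewrite fpsB -(subnKC ijn) (stable (i + j)%N) // subrr.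
Qed.

Definition fps_const (c : K) : fps2 K :=
  fun i j => c * ((i == 0%N) && (j == 0%N))%:R.

Lemma fps_constM c f i j : (fps_const c * f) i j = c * f i j.
Proof.
rewrite fps_coefM big_ord_recl big_ord_recl /= !subn0 /fps_const /= mulr1.
rewrite big1 ?addr0 => [|l _]; last by rewrite mulr0 mul0r.
rewrite big1 ?addr0 // => k _; rewrite big1 // => l _.
by rewrite mulr0 mul0r.
Qed.

Lemma fps_const0 : fps_const 0 = 0.
Proof. by apply: fps_ext => i j; rewrite /fps_const mul0r. Qed.
Lemma fps_const1 : fps_const 1 = 1.
Proof. by apply: fps_ext => i j; rewrite /fps_const mul1r. Qed.
Lemma fps_constMM a b : fps_const (a * b) = fps_const a * fps_const b.
Proof. by apply: fps_ext => i j; rewrite fps_constM /fps_const mulrA. Qed.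
Lemma fps_const_sum (I : Type) (r : seq I) (P : pred I) (F : I -> K) :
  fps_const (\sum_(k <- r | P k) F k) = \sum_(k <- r | P k) fps_const (F k).
Proof.
by apply: fps_ext => i j; rewrite fps_sum /fps_const mulr_suml.
Qed.

(** After division by the constant term, f = 1 - e with e of positive order,
    and the geometric series in e converges formally. *)
Lemma fps_inverse f : f 0%N 0%N != 0 -> exists g, f * g = 1.
Proof.
move=> f0; pose c := fps_const (f 0%N 0%N)^-1; pose e := 1 - c * f.
have e1 : order_ge 1 e.
  by apply: order_ge1; rewrite /e fpsB fps_constM mulVf // subrr.
pose s n : fps2 K := \sum_(k < n.+1) e ^+ k.
have [n|L sL] := @fps_limit s.
  rewrite /s [X in order_ge _ (X - _)]big_ord_recr /= addrAC subrr add0r.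
  exact: order_geX.
exists (c * L); apply: eq_order => n; apply: (@order_ge_leq _ n.+1) => //.
have -> : f * (c * L) - 1 = f * c * (L - s n) - e ^+ n.+1.
  have -> : e ^+ n.+1 = 1 + (e - 1) * s n by rewrite -subrX1 addrC subrK.
  by rewrite /e; ring.
by apply: order_geB; [apply: order_geMl|apply: order_geX].
Qed.

End Order.

(** * The partial derivatives are derivations *)
Section Derivation.
Variable K : numFieldType.
Implicit Types f g h : fps2 K.

Definition fps_swap f : fps2 K := fun i j => f j i.

Lemma fps_swapM f g : fps_swap (f * g) = fps_swap f * fps_swap g.
Proof. by apply: fps_ext => i j; rewrite /fps_swap !fps_coefM exchange_big. Qed.

Lemma fps_dxM f g : fps_dx (f * g) = fps_dx f * g + f * fps_dx g.
Proof.
apply: fps_ext => i j; pose n := (maxn i j).+2.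
have ile : (i <= maxn i j)%N by apply: leq_maxl.
have jle : (j <= maxn i j)%N by apply: leq_maxr.
have lt1 k : (k <= i)%N -> (k.+1 < n)%N.
  by move=> ki; rewrite !ltnS; apply: leq_trans ile.
have lt2 l : (l <= j)%N -> (l < n)%N.
  by move=> lj; rewrite !ltnS leqW //; apply: leq_trans jle.
have Tn h k l : (k <= i)%N -> (l <= j)%N -> (trunc n h)`_k`_l = h k l.
  move=> ki lj; rewrite coef_trunc //; [exact: ltnW (lt1 _ ki)|exact: lt2].
have dT h k l : (k <= i)%N -> (l <= j)%N ->
    ((trunc n h)^`())`_k`_l = fps_dx h k l.
  move=> ki lj; rewrite coef_deriv coefMn coef_trunc //; [exact: lt1|exact: lt2].
rewrite fpsD [(_ * g) i j](fps_mulE (dT f) (Tn g)).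
rewrite [(f * _) i j](fps_mulE (Tn f) (dT g)) -!coefD -derivM.
rewrite coef_deriv coefMn -(fps_mul_trunc f g).
- by [].
- exact: lt1.
- exact: lt2.
Qed.

Lemma fps_swapD f g : fps_swap (f + g) = fps_swap f + fps_swap g.
Proof. by []. Qed.

Lemma fps_swapK f : fps_swap (fps_swap f) = f. Proof. by []. Qed.

Lemma fps_dyE f : fps_dy f = fps_swap (fps_dx (fps_swap f)). Proof. by []. Qed.

Lemma fps_dyM f g : fps_dy (f * g) = fps_dy f * g + f * fps_dy g.
Proof.
rewrite !fps_dyE fps_swapM fps_dxM fps_swapD !fps_swapM.
by rewrite !(fps_swapK f, fps_swapK g).
Qed.

Lemma fps_dxD f g : fps_dx (f + g) = fps_dx f + fps_dx g.
Proof. by apply: fps_ext => i j; rewrite /fps_dx !fpsD mulrnDl. Qed.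
Lemma fps_dyD f g : fps_dy (f + g) = fps_dy f + fps_dy g.
Proof. by apply: fps_ext => i j; rewrite /fps_dy !fpsD mulrnDl. Qed.
Lemma fps_dx1 : fps_dx (1 : fps2 K) = 0.
Proof. by apply: fps_ext => i j; rewrite /fps_dx mul0rn. Qed.
Lemma fps_dy1 : fps_dy (1 : fps2 K) = 0.
Proof.
apply: fps_ext => i j.
by rewrite /fps_dy [_ i j.+1]/(fps_one _ _ _) /fps_one andbF mul0rn.
Qed.
End Derivation.

(** * Composition of power series *)
Section Convolution.

Lemma sum_conv (V : nmodType) n (h : nat -> nat -> V) :
  \sum_(a < n) \sum_(k < a.+1) h k (a - k)%N =
  \sum_(k < n) \sum_(m < n | (k + m < n)%N) h k m.
Proof.
transitivity (\sum_(a < n) \sum_(k < n | (k <= a)%N) h k (a - k)%N).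
  apply: eq_bigr => a _.
  by rewrite (big_ord_widen n (fun k => h k (a - k)%N)) ?ltn_ord.
rewrite (exchange_big_dep predT) //=; apply: eq_bigr => k _.
rewrite (eq_bigl (fun a : 'I_n => true && (k <= a)%N)) //.
rewrite -(big_geq_mkord _ _ predT (fun a => h k (a - k)%N)).
rewrite -{1}[val k]add0n big_addn big_mkord.
rewrite (big_ord_widen n (fun m => h k (m + k - k)%N)) ?leq_subr //.
by apply: eq_big => [m|m _]; rewrite ?addnK // ltn_subRL.
Qed.

(** Rearrangement of a double Cauchy product over a box.  The terms on the
    right form a part of the full product of sums over the box: the missing
    ones have high order, which makes composition multiplicative, or are
    nonnegative, which makes the box norm submultiplicative. *)
Lemma sum_conv2 (V : nmodType) n (G : nat -> nat -> nat -> nat -> V) :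
  \sum_(i < n) \sum_(j < n) \sum_(k < i.+1) \sum_(l < j.+1)
     G k (i - k)%N l (j - l)%N =
  \sum_(k < n) \sum_(k' < n | (k + k' < n)%N)
    \sum_(l < n) \sum_(l' < n | (l + l' < n)%N) G k k' l l'.
Proof.
under eq_bigr => i _ do rewrite exchange_big.
rewrite (sum_conv _ (fun k k' =>
  \sum_(j < n) \sum_(l < j.+1) G k k' l (j - l)%N)).
by apply: eq_bigr => k _; apply: eq_bigr => k' _; rewrite (sum_conv _ (G k k')).
Qed.

End Convolution.

Section Composition.
Variable K : numFieldType.
Implicit Types f g h p q : fps2 K.

(** The truncated composite is an element of the ring, to which ring identities
    apply; it approximates the composite to order n. *)
Definition partial_comp n f p q : fps2 K :=
  \sum_(k < n) \sum_(l < n) fps_const (f k l) * (p ^+ k * q ^+ l).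

Lemma fps_compE f p q i j :
  fps_comp f p q i j =
  \sum_(k < (i + j).+1) \sum_(l < (i + j).+1) f k l * (p ^+ k * q ^+ l) i j.
Proof.
by apply: eq_bigr => k _; apply: eq_bigr => l _; rewrite !fps_expE.
Qed.

Lemma partial_compE n f p q i j :
  partial_comp n f p q i j =
  \sum_(k < n) \sum_(l < n) f k l * (p ^+ k * q ^+ l) i j.
Proof.
rewrite /partial_comp fps_sum; apply: eq_bigr => k _.
by rewrite fps_sum; apply: eq_bigr => l _; rewrite fps_constM.
Qed.

Lemma comp_partial n f p q : order_ge 1 p -> order_ge 1 q ->
  order_ge n ((fps_comp f p q : fps2 K) - partial_comp n f p q).
Proof.
move=> p1 q1 i j ijn; apply/eqP; rewrite fpsB subr_eq0; apply/eqP.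
rewrite fps_compE partial_compE.
have small k l : (i + j < k + l)%N -> (p ^+ k * q ^+ l) i j = 0.
  exact: order_ge_mon.
rewrite [LHS](big_ord_widen n (fun k => \sum_(l < (i + j).+1)
  f k l * (p ^+ k * q ^+ l) i j)) // [RHS](bigID (fun k : 'I_n => (k < (i + j).+1)%N)) /=.
rewrite [X in _ = _ + X]big1 ?addr0 => [|k]; last first.
  rewrite -leqNgt => k_big; rewrite big1 // => l _.
  by rewrite small ?mulr0 // (leq_trans k_big) ?leq_addr.
apply: eq_bigr => k _.
rewrite [LHS](big_ord_widen n (fun l => f k l * (p ^+ k * q ^+ l) i j)) //.
rewrite [RHS](bigID (fun l : 'I_n => (l < (i + j).+1)%N)) /=.
rewrite [X in _ = _ + X]big1 ?addr0 // => l; rewrite -leqNgt => l_big.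
by rewrite small ?mulr0 // (leq_trans l_big) ?leq_addl.
Qed.

Lemma fps_compD f g p q :
  fps_comp (f + g) p q = (fps_comp f p q : fps2 K) + fps_comp g p q.
Proof.
apply: fps_ext => i j; rewrite fpsD !fps_compE -big_split; apply: eq_bigr => k _.
by rewrite -big_split; apply: eq_bigr => l _; rewrite fpsD mulrDl.
Qed.

Lemma fps_comp_const c p q : fps_comp (fps_const c) p q = fps_const c.
Proof.
apply: fps_ext => i j; rewrite fps_compE big_ord_recl big_ord_recl /=.
rewrite big1 ?addr0 => [|l _]; last by rewrite /fps_const mulr0 mul0r.
rewrite big1 ?addr0 => [|k _]; last first.
  by rewrite big1 // => l _; rewrite /fps_const mulr0 mul0r.
by rewrite !expr0 mulr1 {1}/fps_const mulr1.
Qed.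

Lemma fps_comp0 p q : fps_comp 0 p q = 0.
Proof. by rewrite -fps_const0 fps_comp_const. Qed.

Lemma order_ge_comp n f p q : order_ge 1 p -> order_ge 1 q ->
  order_ge n f -> order_ge n (fps_comp f p q).
Proof.
move=> p1 q1 fn i j ijn; rewrite fps_compE big1 // => k _; rewrite big1 // => l _.
have [/fn ->|nkl] := ltnP (k + l) n; first by rewrite mul0r.
by rewrite (order_ge_mon (k := k) (l := l) p1 q1) ?mulr0 // (leq_trans ijn).
Qed.

Lemma order_ge_compB n f g p q : order_ge 1 p -> order_ge 1 q ->
  order_ge n (f - g) ->
  order_ge n ((fps_comp f p q : fps2 K) - fps_comp g p q).
Proof.
move=> p1 q1 fg; rewrite -[X in fps_comp X](subrK g) fps_compD addrK.
exact: order_ge_comp.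
Qed.

Lemma fps_compM f g p q : order_ge 1 p -> order_ge 1 q ->
  fps_comp (f * g) p q = (fps_comp f p q : fps2 K) * fps_comp g p q.
Proof.
move=> p1 q1; apply: eq_order => n.
have part h := @comp_partial n h p q p1 q1.
apply: (order_ge_sub_trans (part _)).
apply: (@order_ge_sub_trans _ _ _ (partial_comp n f p q * partial_comp n g p q)).
  (* Both truncated composites are sums of the same terms G; the product has
     in addition those with k + k' >= n or l + l' >= n, of order >= n. *)
  pose G k k' l l' := fps_const (f k l) * fps_const (g k' l') *
    (p ^+ (k + k') * q ^+ (l + l')).
  have -> : partial_comp n (f * g) p q = \sum_(k < n) \sum_(k' < n | (k + k' < n)%N)
      \sum_(l < n) \sum_(l' < n | (l + l' < n)%N) G k k' l l'.
    rewrite -sum_conv2; apply: eq_bigr => i _; apply: eq_bigr => j _.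
    rewrite fps_coefM fps_const_sum mulr_suml; apply: eq_bigr => k _.
    rewrite fps_const_sum mulr_suml; apply: eq_bigr => l _.
    by rewrite /G fps_constMM !subnKC -1?ltnS.
  have -> : partial_comp n f p q * partial_comp n g p q =
      \sum_(k < n) \sum_(k' < n) \sum_(l < n) \sum_(l' < n) G k k' l l'.
    rewrite /partial_comp mulr_suml; apply: eq_bigr => k _.
    rewrite mulr_sumr; apply: eq_bigr => k' _.
    rewrite mulr_suml; apply: eq_bigr => l _.
    rewrite mulr_sumr; apply: eq_bigr => l' _.
    by rewrite /G !exprD; ring.
  have Gbig (k k' l l' : nat) : (n <= k + k')%N || (n <= l + l')%N -> order_ge n (G k k' l l').
    move=> big; apply: order_geMl; apply: order_ge_leq (order_ge_mon p1 q1).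
    case/orP: big => [le_n|le_n]; apply: leq_trans le_n _.
      exact: leq_addr.
    exact: leq_addl.
  rewrite -sumrB; apply: order_ge_sum => k _.
  rewrite [X in _ - X](bigID (fun k' : 'I_n => (k + k' < n)%N)) /= opprD addrA.
  apply: order_geB; last first.
    apply: order_ge_sum => k'; rewrite -leqNgt => big.
    apply: order_ge_sum => l _; apply: order_ge_sum => l' _.
    by apply: Gbig; rewrite big.
  rewrite -sumrB; apply: order_ge_sum => k' _.
  rewrite -sumrB; apply: order_ge_sum => l _.
  rewrite [X in _ - X](bigID (fun l' : 'I_n => (l + l' < n)%N)) /= opprD addrA.
  rewrite subrr sub0r; apply: order_geN; apply: order_ge_sum => l'.
  by rewrite -leqNgt => big; apply: Gbig; rewrite big orbT.
apply: order_ge_subC.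
set a := fps_comp f p q; set b := fps_comp g p q.
set a' := partial_comp _ f _ _; set b' := partial_comp _ _ _ _.
have -> : (a : fps2 K) * b - a' * b' = b * (a - a') + a' * (b - b') by ring.
by apply: order_geD; apply: order_geMl; apply: part.
Qed.

Lemma fps_compX f p q k : order_ge 1 p -> order_ge 1 q ->
  fps_comp (f ^+ k) p q = (fps_comp f p q : fps2 K) ^+ k.
Proof.
move=> p1 q1; elim: k => [|k IH].
  by rewrite !expr0 -fps_const1 fps_comp_const.
by rewrite !exprS fps_compM // IH.
Qed.

Lemma fps_comp_sum (I : Type) (r : seq I) (P : pred I) (F : I -> fps2 K) p q :
  fps_comp (\sum_(k <- r | P k) F k) p q =
  \sum_(k <- r | P k) (fps_comp (F k) p q : fps2 K).
Proof.
by apply: (big_morph (fun f => fps_comp f p q : fps2 K)) => [f g|];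
  rewrite ?fps_compD ?fps_comp0.
Qed.

Lemma fps_compA f p q p' q' :
    order_ge 1 p -> order_ge 1 q -> order_ge 1 p' -> order_ge 1 q' ->
  fps_comp (fps_comp f p q) p' q' =
  fps_comp f (fps_comp p p' q') (fps_comp q p' q').
Proof.
move=> p1 q1 p'1 q'1; apply: eq_order => n.
have pp'1 : order_ge 1 (fps_comp p p' q') by apply: order_ge_comp.
have qq'1 : order_ge 1 (fps_comp q p' q') by apply: order_ge_comp.
apply: (order_ge_sub_trans (order_ge_compB p'1 q'1 (@comp_partial n f p q p1 q1))).
apply: order_ge_subC; apply: (order_ge_sub_trans (@comp_partial n f _ _ pp'1 qq'1)).
suff -> : fps_comp (partial_comp n f p q) p' q' =
  partial_comp n f (fps_comp p p' q') (fps_comp q p' q') by rewrite subrr.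
rewrite /partial_comp fps_comp_sum; apply: eq_bigr => k _.
rewrite fps_comp_sum; apply: eq_bigr => l _.
by rewrite !fps_compM // !fps_compX // fps_comp_const.
Qed.

Lemma fps_comp_linear f p q : linear_form f -> order_ge 1 p -> order_ge 1 q ->
  fps_comp f p q = fps_const (f 1%N 0%N) * p + fps_const (f 0%N 1%N) * q.
Proof.
move=> f1 p1 q1; apply: eq_order => n.
apply: (@order_ge_leq _ _ n.+2); first by rewrite !leqW.
apply: (order_ge_sub_trans (@comp_partial n.+2 f p q p1 q1)).
have f0 k l : (k + l)%N != 1%N -> fps_const (f k l) = 0.
  by move=> kl; rewrite f1 // fps_const0.
rewrite /partial_comp !big_ord_recl /= !big1 => [|k _|l _|l _]; last 3 first.
- by rewrite !big_ord_recl /= !f0 // !mul0r !add0r big1 // => l _; rewrite f0 // mul0r.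
- by rewrite f0 // mul0r.
- by rewrite f0 // mul0r.
rewrite -[bump 0 0]/1%N (f0 0%N 0%N) // (f0 1%N 1%N) // !mul0r !addr0 !add0r.
rewrite !expr0 !expr1 mul1r mulr1.
by rewrite [X in X - _]addrC subrr.
Qed.

Lemma linear_fps_x : linear_form (fps_x : fps2 K).
Proof. by move=> [|[|i]] [|[|j]]. Qed.
Lemma linear_fps_y : linear_form (fps_y : fps2 K).
Proof. by move=> [|[|i]] [|[|j]]. Qed.

Lemma fps_comp_x p q : order_ge 1 p -> order_ge 1 q -> fps_comp fps_x p q = p.
Proof.
move=> p1 q1; rewrite (fps_comp_linear linear_fps_x p1 q1).
by rewrite fps_const1 fps_const0 mul1r mul0r addr0.
Qed.

Lemma fps_comp_y p q : order_ge 1 p -> order_ge 1 q -> fps_comp fps_y p q = q.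
Proof.
move=> p1 q1; rewrite (fps_comp_linear linear_fps_y p1 q1).
by rewrite fps_const1 fps_const0 mul1r mul0r add0r.
Qed.

Lemma order_fps_x : order_ge 1 (fps_x : fps2 K). Proof. exact: order_ge1. Qed.
Lemma order_fps_y : order_ge 1 (fps_y : fps2 K). Proof. exact: order_ge1. Qed.

Lemma coef_fps_xM f i j : (fps_x * f) i j = if i is i'.+1 then f i' j else 0.
Proof.
rewrite fps_coefM; case: i => [|i].
  by rewrite big_ord1 big1 // => l _; rewrite mul0r.
rewrite big_ord_recl [X in X + _]big1 ?add0r => [|l _]; last by rewrite mul0r.
rewrite big_ord_recl [X in _ + X]big1 ?addr0 => [|k _]; last first.
  by rewrite big1 // => l _; rewrite mul0r.
rewrite big_ord_recl [X in _ + X]big1 ?addr0 => [|l _]; last by rewrite mul0r.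
by rewrite mul1r subn0 /= subSS subn0.
Qed.

Lemma coef_fps_yM f i j : (fps_y * f) i j = if j is j'.+1 then f i j' else 0.
Proof.
have yx : fps_y = fps_swap fps_x :> fps2 K.
  by apply: fps_ext => a b; rewrite /fps_swap /fps_y /fps_x andbC.
have -> : fps_y * f = fps_swap (fps_x * fps_swap f) by rewrite fps_swapM yx.
by rewrite /fps_swap coef_fps_xM.
Qed.

Lemma coef_monomial k l i j :
  (fps_x ^+ k * fps_y ^+ l : fps2 K) i j = ((i == k) && (j == l))%:R.
Proof.
elim: k i => [|k IH] i; last first.
  by rewrite exprS -mulrA coef_fps_xM; case: i => [|i] //; rewrite IH.
rewrite expr0 mul1r; elim: l j => [|l IH] j //.
by rewrite exprS coef_fps_yM; case: j => [|j]; rewrite ?andbF ?IH.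
Qed.

Lemma fps_comp_id f : fps_comp f fps_x fps_y = f.
Proof.
apply: fps_ext => i j; rewrite fps_compE.
have li : (i < (i + j).+1)%N by rewrite ltnS leq_addr.
have lj : (j < (i + j).+1)%N by rewrite ltnS leq_addl.
rewrite (bigD1 (Ordinal li)) //= (bigD1 (Ordinal lj)) //=.
rewrite coef_monomial !eqxx mulr1 !big1 ?addr0 // => [k ki|l lj'].
  have {}ki : (nat_of_ord k == i) = false := negbTE ki.
  by rewrite big1 // => l _; rewrite coef_monomial eq_sym ki mulr0.
have {}lj' : (nat_of_ord l == j) = false := negbTE lj'.
by rewrite coef_monomial [j == l]eq_sym lj' andbF mulr0.
Qed.

Lemma order_ge_subX n p p' k : order_ge 1 p -> order_ge 1 p' ->
  order_ge n (p - p') -> order_ge (n + k) (p ^+ k.+1 - p' ^+ k.+1).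
Proof.
move=> p1 p'1 pp'; elim: k => [|k IH]; first by rewrite addn0 !expr1.
have -> : p ^+ k.+2 - p' ^+ k.+2 =
    p * (p ^+ k.+1 - p' ^+ k.+1) + (p - p') * p' ^+ k.+1.
  by rewrite !exprS; ring.
apply: order_geD.
  by rewrite addnS -add1n; apply: order_geM.
by apply: order_geM => //; apply: order_geX.
Qed.

(** The key to formal inversion: every monomial of degree at least two gains one
    order when differences are taken. *)
Lemma comp_contract n f p q p' q' : order_ge 2 f ->
    order_ge 1 p -> order_ge 1 q -> order_ge 1 p' -> order_ge 1 q' ->
    order_ge n (p - p') -> order_ge n (q - q') ->
  order_ge n.+1 ((fps_comp f p q : fps2 K) - fps_comp f p' q').
Proof.
move=> f2 p1 q1 p'1 q'1 pp' qq' i j ijn.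
rewrite fpsB !fps_compE -sumrB big1 // => k _; rewrite -sumrB big1 // => l _.
have [/f2 ->|kl2] := ltnP (k + l) 2; first by rewrite !mul0r subrr.
rewrite -mulrBr -fpsB.
suff -> : (p ^+ k * q ^+ l - p' ^+ k * q' ^+ l) i j = 0 by rewrite mulr0.
suff ord : order_ge n.+1 (p ^+ k * q ^+ l - p' ^+ k * q' ^+ l) by apply: ord.
move: (nat_of_ord k) (nat_of_ord l) kl2 => {}k {}l kl2.
have -> : p ^+ k * q ^+ l - p' ^+ k * q' ^+ l =
   (p ^+ k - p' ^+ k) * q ^+ l + p' ^+ k * (q ^+ l - q' ^+ l) by ring.
apply: order_geD.
  case: k kl2 => [|k] kl2; first by rewrite !expr0 subrr mul0r.
  apply: (@order_ge_leq _ _ ((n + k) + l)); last first.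
    by apply: order_geM; [apply: order_ge_subX|apply: order_geX].
  by rewrite -addnA -addn1 leq_add2l.
case: l kl2 => [|l] kl2; first by rewrite !expr0 subrr mulr0.
apply: (@order_ge_leq _ _ (k + (n + l))); last first.
  by apply: order_geM; [apply: order_geX|apply: order_ge_subX].
by rewrite addnCA -addn1 leq_add2l -ltnS -addnS.
Qed.

End Composition.

(** * Geometric bounds on the coefficients *)
Section Bounds.
Variable K : numFieldType.
Implicit Types f g h p q : fps2 K.

Definition geom_bounded f : Prop :=
  exists M rho : K, [/\ 0 <= M, 1 <= rho &
    forall i j, `|f i j| <= M * rho ^+ (i + j)].

Lemma geom_bounded2 f g : geom_bounded f -> geom_bounded g ->
  exists M rho : K, [/\ 0 <= M, 1 <= rho,
    forall i j, `|f i j| <= M * rho ^+ (i + j) &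
    forall i j, `|g i j| <= M * rho ^+ (i + j)].
Proof.
move=> [M [rho [M0 rho1 fM]]] [N [sig [N0 sig1 gN]]].
have rho0 := le_trans ler01 rho1; have sig0 := le_trans ler01 sig1.
exists (M + N), (rho + sig); split => [|||i j].
- exact: addr_ge0.
- by apply: le_trans rho1 _; rewrite lerDl.
- move=> i j; apply: le_trans (fM i j) _; apply: ler_pM; rewrite ?exprn_ge0 //.
    by rewrite lerDl.
  by apply: lerXn2r; rewrite ?nnegrE ?addr_ge0 // lerDl.
- apply: le_trans (gN i j) _; apply: ler_pM; rewrite ?exprn_ge0 //.
    by rewrite lerDr.
  by apply: lerXn2r; rewrite ?nnegrE ?addr_ge0 // lerDr.
Qed.

Lemma geom_boundedD f g :
  geom_bounded f -> geom_bounded g -> geom_bounded (f + g).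
Proof.
move=> fb gb; have [M [rho [M0 rho1 fM gM]]] := geom_bounded2 fb gb.
exists (M + M), rho; split => // [|i j]; first exact: addr_ge0.
by rewrite mulrDl; apply: le_trans (ler_normD _ _) _; apply: lerD.
Qed.

Lemma geom_boundedN f : geom_bounded f -> geom_bounded (- f).
Proof.
move=> [M [rho [M0 rho1 fM]]]; exists M, rho; split => // i j.
by rewrite fpsN normrN.
Qed.

Lemma le_exp2 n : n.+1%:R <= 2 ^+ n :> K.
Proof. by rewrite -natrX ler_nat ltn_expl. Qed.

Lemma geom_boundedM f g :
  geom_bounded f -> geom_bounded g -> geom_bounded (f * g).
Proof.
move=> fb gb; have [M [rho [M0 rho1 fM gM]]] := geom_bounded2 fb gb.
have rho0 := le_trans ler01 rho1.
exists (M * M), (2 * rho); split => [||i j]; first exact: mulr_ge0.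
  by apply: mulr_ege1 => //; rewrite ler1n.
rewrite fps_coefM.
apply: (@le_trans _ _ (\sum_(k < i.+1) \sum_(l < j.+1) M * M * rho ^+ (i + j))).
  apply: le_trans (ler_norm_sum _ _ _) _; apply: ler_sum => k _.
  apply: le_trans (ler_norm_sum _ _ _) _; apply: ler_sum => l _.
  have -> : (i + j = (k + l) + ((i - k) + (j - l)))%N.
    by rewrite addnACA !subnKC -1?ltnS.
  rewrite normrM exprD mulrACA; apply: ler_pM => //; exact: fM.
under eq_bigr do rewrite sumr_const card_ord.
rewrite sumr_const card_ord -mulrnA -[leLHS]mulr_natl exprMn mulrCA.
rewrite ler_wpM2l ?mulr_ge0 // ler_wpM2r ?exprn_ge0 //.
by rewrite mulnC natrM exprD ler_pM ?ler0n ?le_exp2.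
Qed.

Lemma geom_bounded_dx f : geom_bounded f -> geom_bounded (fps_dx f).
Proof.
move=> [M [rho [M0 rho1 fM]]]; have rho0 := le_trans ler01 rho1.
exists (M * rho), (2 * rho); split => [||i j]; first exact: mulr_ge0.
  by apply: mulr_ege1 => //; rewrite ler1n.
rewrite /fps_dx normrMn -[leLHS]mulr_natl exprMn mulrCA ler_pM ?ler0n //.
  apply: le_trans (le_exp2 _) _.
  by apply: ler_weXn2l; rewrite ?ler1n ?leq_addr.
by rewrite -mulrA -exprS -addSn.
Qed.

Lemma geom_bounded_swap f : geom_bounded f -> geom_bounded (fps_swap f).
Proof.
move=> [M [rho [M0 rho1 fM]]]; exists M, rho; split => // i j.
by rewrite /fps_swap addnC.
Qed.

Lemma geom_bounded_dy f : geom_bounded f -> geom_bounded (fps_dy f).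
Proof.
move=> fb; rewrite fps_dyE.
exact/geom_bounded_swap/geom_bounded_dx/geom_bounded_swap.
Qed.

Lemma geom_bounded_finite f n :
  (forall i j, (n <= i + j)%N -> f i j = 0) -> geom_bounded f.
Proof.
move=> f0; pose M := \sum_(i < n) \sum_(j < n) `|f i j|.
have M0 : 0 <= M by do 2! apply: sumr_ge0 => ? _.
exists M, 1; split => // i j; rewrite expr1n mulr1.
have [/f0 ->|ijn] := leqP n (i + j); first by rewrite normr0.
have lin := leq_ltn_trans (leq_addr j i) ijn.
have ljn := leq_ltn_trans (leq_addl i j) ijn.
rewrite /M (bigD1 (Ordinal lin)) //= (bigD1 (Ordinal ljn)) //= -addrA lerDl.
by rewrite addr_ge0 //; do ?[apply: sumr_ge0 => ? _].
Qed.

Lemma geom_bounded1 : geom_bounded (1 : fps2 K).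
Proof. by apply: (@geom_bounded_finite _ 1) => [[|i] [|j]]. Qed.
Lemma geom_bounded_x : geom_bounded (fps_x : fps2 K).
Proof. by apply: (@geom_bounded_finite _ 2) => [[|[|i]] [|[|j]]]. Qed.
Lemma geom_bounded_y : geom_bounded (fps_y : fps2 K).
Proof. by apply: (@geom_bounded_finite _ 2) => [[|[|i]] [|[|j]]]. Qed.

Lemma sum_half n : \sum_(k < n) (2^-1 : K) ^+ k <= 2.
Proof.
have -> : \sum_(k < n) (2^-1 : K) ^+ k = 2 - 2 * 2^-1 ^+ n.
  elim: n => [|n IH]; first by rewrite big_ord0 expr0 mulr1 subrr.
  by rewrite big_ord_recr /= IH exprS mulrA divff ?pnatr_eq0 // mul1r; ring.
by rewrite gerBl mulr_ge0 ?exprn_ge0 ?invr_ge0 ?ler0n.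
Qed.

(** All double sums in the estimates below are compared with the double
    geometric series of ratio 1/2, whose sum is 4. *)
Lemma sum_half2 m n (c : nat -> nat -> K) (M : K) : 0 <= M ->
  (forall k l, (k < m)%N -> (l < n)%N -> c k l <= M * 2^-1 ^+ (k + l)) ->
  \sum_(k < m) \sum_(l < n) c k l <= 4 * M.
Proof.
move=> M0 cM.
have h0 k : 0 <= (2^-1 : K) ^+ k by rewrite exprn_ge0 ?invr_ge0 ?ler0n.
apply: (@le_trans _ _ (\sum_(k < m) \sum_(l < n)
    M * (2^-1 ^+ k * 2^-1 ^+ l))).
  apply: ler_sum => k _; apply: ler_sum => l _.
  by rewrite -exprD; apply: cM.
under eq_bigr do rewrite -mulr_sumr -mulr_sumr.
rewrite -mulr_sumr -mulr_suml mulrC ler_wpM2r //.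
have -> : 4 = 2 * 2 :> K by rewrite -natrM.
by apply: ler_pM; rewrite ?sum_half //; apply: sumr_ge0.
Qed.

End Bounds.

(** * Weighted l1 norms on boxes of coefficients *)
Section Norm.
Variables (K : numFieldType) (r : K).
Hypothesis r0 : 0 <= r.
Implicit Types f g h p q : fps2 K.

(** The l1 norm on the bidisc of radius r, truncated to the box i, j < N.  The
    truncation keeps it finite for formal series; bounds uniform in N give
    convergence. *)
Definition boxnorm N f : K := \sum_(i < N) \sum_(j < N) `|f i j| * r ^+ (i + j).

Let rX n : 0 <= r ^+ n. Proof. exact: exprn_ge0. Qed.

Lemma boxnorm_ge0 N f : 0 <= boxnorm N f.
Proof. by do 2! apply: sumr_ge0 => ? _; rewrite mulr_ge0. Qed.

Lemma boxnormD N f g : boxnorm N (f + g) <= boxnorm N f + boxnorm N g.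
Proof.
rewrite -big_split; apply: ler_sum => i _.
rewrite -big_split; apply: ler_sum => j _ /=.
by rewrite -mulrDl ler_wpM2r // ler_normD.
Qed.

Lemma boxnormN N f : boxnorm N (- f) = boxnorm N f.
Proof.
by apply: eq_bigr => i _; apply: eq_bigr => j _; rewrite fpsN normrN.
Qed.

Lemma boxnorm_sum N (I : Type) (s : seq I) (P : pred I) (F : I -> fps2 K) :
  boxnorm N (\sum_(k <- s | P k) F k) <= \sum_(k <- s | P k) boxnorm N (F k).
Proof.
elim/big_rec2: _ => [|k x y _ IH].
  by rewrite /boxnorm big1 // => i _; rewrite big1 // => j _; rewrite normr0 mul0r.
by apply: le_trans (boxnormD _ _ _) _; rewrite lerD2l.
Qed.

Lemma boxnorm_const N c f : boxnorm N (fps_const c * f) = `|c| * boxnorm N f.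
Proof.
rewrite /boxnorm mulr_sumr; apply: eq_bigr => i _; rewrite mulr_sumr.
by apply: eq_bigr => j _; rewrite fps_constM normrM mulrA.
Qed.

Lemma boxnormM N f g : boxnorm N (f * g) <= boxnorm N f * boxnorm N g.
Proof.
pose G k k' l l' := (`|f k l| * r ^+ (k + l)) * (`|g k' l'| * r ^+ (k' + l')).
have G0 k k' l l' : 0 <= G k k' l l' by rewrite !mulr_ge0.
apply: (@le_trans _ _ (\sum_(i < N) \sum_(j < N) \sum_(k < i.+1)
    \sum_(l < j.+1) G k (i - k)%N l (j - l)%N)).
  apply: ler_sum => i _; apply: ler_sum => j _; rewrite fps_coefM.
  rewrite (le_trans (ler_wpM2r _ (ler_norm_sum _ _ _))) // mulr_suml.
  apply: ler_sum => k _.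
  rewrite (le_trans (ler_wpM2r _ (ler_norm_sum _ _ _))) // mulr_suml.
  apply: ler_sum => l _; rewrite /G normrM mulrACA -exprD.
  by rewrite addnACA !subnKC -1?ltnS.
rewrite sum_conv2 /boxnorm mulr_suml; apply: ler_sum => k _.
rewrite mulr_sumr big_mkcond; apply: ler_sum => k' _.
rewrite mulr_suml; case: ifP => _; last first.
  by apply: sumr_ge0 => l _; rewrite mulr_sumr; apply: sumr_ge0 => l' _;
    apply: (G0 k k' l l').
apply: ler_sum => l _; rewrite mulr_sumr big_mkcond; apply: ler_sum => l' _.
by case: ifP => _ //; apply: G0.
Qed.

Lemma boxnorm1 N : boxnorm N 1 <= 1.
Proof.
case: N => [|N]; first by rewrite /boxnorm big_ord0 ler01.
rewrite /boxnorm big_ord_recl big_ord_recl /= normr1 mulr1.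
rewrite big1 ?addr0 => [|l _]; last by rewrite normr0 mul0r.
by rewrite big1 ?addr0 // => k _; rewrite big1 // => l _; rewrite normr0 mul0r.
Qed.

Lemma boxnormX N f k : boxnorm N (f ^+ k) <= boxnorm N f ^+ k.
Proof.
elim: k => [|k IH]; first exact: boxnorm1.
rewrite !exprS; apply: le_trans (boxnormM _ _ _) _.
by rewrite ler_wpM2l ?boxnorm_ge0.
Qed.

Lemma boxnorm_eq N f g : order_ge (N + N) (f - g) -> boxnorm N f = boxnorm N g.
Proof.
move=> fg; apply: eq_bigr => i _; apply: eq_bigr => j _; congr (`|_| * _).
apply/eqP; rewrite -subr_eq0 -fpsB fg //.
by rewrite -addSn leq_add // ltnW.
Qed.

Lemma boxnorm_comp N f p q s : order_ge 1 p -> order_ge 1 q ->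
  boxnorm N p <= s -> boxnorm N q <= s ->
  boxnorm N (fps_comp f p q) <=
    \sum_(k < N + N) \sum_(l < N + N) `|f k l| * s ^+ (k + l).
Proof.
move=> p1 q1 ps qs; rewrite (boxnorm_eq (comp_partial _ p1 q1)).
apply: le_trans (boxnorm_sum _ _ _ _) _; apply: ler_sum => k _.
apply: le_trans (boxnorm_sum _ _ _ _) _; apply: ler_sum => l _.
rewrite boxnorm_const ler_wpM2l //; apply: le_trans (boxnormM _ _ _) _.
rewrite exprD; apply: ler_pM; rewrite ?boxnorm_ge0 //.
  by apply: le_trans (boxnormX _ _ _) _; 
  apply: lerXn2r; rewrite ?nnegrE ?boxnorm_ge0 // (le_trans _ ps) ?boxnorm_ge0.
by apply: le_trans (boxnormX _ _ _) _; 
  apply: lerXn2r; rewrite ?nnegrE ?boxnorm_ge0 // (le_trans _ qs) ?boxnorm_ge0.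
Qed.

Lemma boxnorm_coef N f i j : (i < N)%N -> (j < N)%N ->
  `|f i j| * r ^+ (i + j) <= boxnorm N f.
Proof.
move=> lin ljn; rewrite /boxnorm (bigD1 (Ordinal lin)) //= (bigD1 (Ordinal ljn)) //=.
rewrite -addrA lerDl addr_ge0 //.
  by apply: sumr_ge0 => ? _; rewrite mulr_ge0.
by do 2! apply: sumr_ge0 => ? _; rewrite mulr_ge0.
Qed.

Lemma boxnorm_single N f a b :
  (forall i j, f i j = ((i == a) && (j == b))%:R) -> boxnorm N f <= r ^+ (a + b).
Proof.
move=> fE; rewrite /boxnorm; under eq_bigr do under eq_bigr do rewrite fE.
have [aN|aN] := ltnP a N; last first.
  rewrite big1 // => i _; rewrite big1 // => j _.
  have ia : (i == a :> nat) = false by rewrite ltn_eqF // (leq_trans _ aN).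
  by rewrite ia normr0 mul0r.
have [bN|bN] := ltnP b N; last first.
  rewrite big1 // => i _; rewrite big1 // => j _.
  have jb : (j == b :> nat) = false by rewrite ltn_eqF // (leq_trans _ bN).
  by rewrite jb andbF normr0 mul0r.
rewrite (bigD1 (Ordinal aN)) //= (bigD1 (Ordinal bN)) //= !eqxx normr1 mul1r.
rewrite !big1 ?addr0 // => [i|j] ne.
  have {}ne : (i == a :> nat) = false := negbTE ne.
  by rewrite big1 // => j _; rewrite ne normr0 mul0r.
have {}ne : (j == b :> nat) = false := negbTE ne.
by rewrite ne andbF normr0 mul0r.
Qed.

End Norm.

(** * The inverse function theorem *)
Section InverseMap.
Variable K : numFieldType.
Implicit Types f g h p q : fps2 K.

Lemma sum_order2 (M rho s : K) f n : 0 <= M -> 1 <= rho -> 0 <= s ->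
    2 * rho * s <= 1 -> order_ge 2 f ->
    (forall i j, `|f i j| <= M * rho ^+ (i + j)) ->
  \sum_(k < n) \sum_(l < n) `|f k l| * s ^+ (k + l) <=
    4 * (M * (2 * rho * s) ^+ 2).
Proof.
move=> M0 rho1 s0 small f2 fM; have rho0 := le_trans ler01 rho1.
have th0 : 0 <= 2 * rho * s by rewrite !mulr_ge0 ?ler0n.
apply: (sum_half2 (c := fun k l => `|f k l| * s ^+ (k + l))).
  by rewrite mulr_ge0 ?exprn_ge0.
move=> k l _ _; have [kl2|kl2] := ltnP (k + l) 2.
  rewrite f2 // normr0 mul0r mulr_ge0 ?exprn_ge0 ?invr_ge0 ?ler0n //.
  by rewrite mulr_ge0 ?exprn_ge0.
apply: (@le_trans _ _ (M * (2 * rho * s) ^+ (k + l) * 2^-1 ^+ (k + l))).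
  rewrite -mulrA -exprMn.
  have -> : 2 * rho * s * 2^-1 = rho * s by field.
  by rewrite exprMn mulrA ler_wpM2r ?exprn_ge0.
rewrite ler_wpM2r ?exprn_ge0 ?invr_ge0 ?ler0n // ler_wpM2l //.
exact: ler_wiXn2l.
Qed.

(** Picard iterates for the right inverse Q of id + (f, g), which solves
    Q = id - (f, g) o Q. *)
Definition inv_iter f g (n : nat) : fps2 K * fps2 K :=
  iter n (fun Q => (fps_x - fps_comp f Q.1 Q.2, fps_y - fps_comp g Q.1 Q.2))
    (0, 0).

Lemma inv_iter_order f g n : order_ge 2 f -> order_ge 2 g ->
  order_ge 1 (inv_iter f g n).1 /\ order_ge 1 (inv_iter f g n).2.
Proof.
move=> f2 g2; elim: n => [|n [p1 q1]] //=.
by split; apply: order_geB;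
  rewrite ?(order_fps_x, order_fps_y) //; try exact: order_fps_x;
  try exact: order_fps_y;
  apply: (@order_ge_leq _ _ 2) => //; apply: order_ge_comp.
Qed.

Lemma inv_iter_cauchy f g n : order_ge 2 f -> order_ge 2 g ->
  order_ge n.+1 ((inv_iter f g n.+1).1 - (inv_iter f g n).1) /\
  order_ge n.+1 ((inv_iter f g n.+1).2 - (inv_iter f g n).2).
Proof.
move=> f2 g2; elim: n => [|n [IH1 IH2]].
  have [o1 o2] := inv_iter_order 1 f2 g2.
  by split; apply: order_geB.
have [p1 q1] := inv_iter_order n f2 g2.
have [p1' q1'] := inv_iter_order n.+1 f2 g2.
have subE (a b c : fps2 K) : (a - b) - (a - c) = - (b - c) by ring.
by split; rewrite [inv_iter f g n.+2]/= [in X in _ - X]/= subE;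
  apply: order_geN; apply: comp_contract.
Qed.

(** The iterates stay in the ball of radius 2r: x and y have norm r, and the
    quadratic terms contribute at most 64 M rho^2 r^2 <= r when r is small. *)
Lemma inv_iter_boxnorm f g (M rho r : K) N n :
    order_ge 2 f -> order_ge 2 g -> 0 <= M -> 1 <= rho -> 0 <= r ->
    4 * rho * r <= 1 -> 64 * M * rho ^+ 2 * r <= 1 ->
    (forall i j, `|f i j| <= M * rho ^+ (i + j)) ->
    (forall i j, `|g i j| <= M * rho ^+ (i + j)) ->
  boxnorm r N (inv_iter f g n).1 <= 2 * r /\ boxnorm r N (inv_iter f g n).2 <= 2 * r.
Proof.
move=> f2 g2 M0 rho1 r0 small1 small2 fM gM.
have r20 : 0 <= 2 * r by rewrite mulr_ge0 ?ler0n.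
elim: n => [|n [IH1 IH2]].
  suff -> : boxnorm r N (inv_iter f g 0).1 = 0 by [].
  by rewrite /boxnorm big1 // => i _; rewrite big1 // => j _; rewrite normr0 mul0r.
have [p1 q1] := inv_iter_order n f2 g2.
have comp_le h : order_ge 2 h -> (forall i j, `|h i j| <= M * rho ^+ (i + j)) ->
    boxnorm r N (fps_comp h (inv_iter f g n).1 (inv_iter f g n).2) <= r.
  move=> h2 hM; apply: le_trans (boxnorm_comp r0 h p1 q1 IH1 IH2) _.
  apply: le_trans (sum_order2 _ M0 rho1 r20 _ h2 hM) _.
    suff -> : 2 * rho * (2 * r) = 4 * rho * r by [].
    by ring.
  have -> : 4 * (M * (2 * rho * (2 * r)) ^+ 2) = 64 * M * rho ^+ 2 * r * r.
    by ring.
  by rewrite -[leRHS]mul1r ler_wpM2r.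
have r2 : 2 * r = r + r by ring.
rewrite r2 /=; split; apply: le_trans (boxnormD r0 _ _ _) _; rewrite boxnormN;
  apply: lerD; rewrite ?comp_le //.
  by apply: le_trans (boxnorm_single r0 (a := 1) (b := 0) _ _) _.
by apply: le_trans (boxnorm_single r0 (a := 0) (b := 1) _ _) _.
Qed.

(** In the box i, j < N the limit agrees with the iterate of rank 2N, so that
    it inherits the bound 2r of the iterates for every N. *)
Lemma right_inverse f g : order_ge 2 f -> order_ge 2 g ->
  exists p q : fps2 K,
  [/\ order_ge 1 p, order_ge 1 q,
      p = fps_x - fps_comp f p q, q = fps_y - fps_comp g p q &
      geom_bounded f -> geom_bounded g -> geom_bounded p /\ geom_bounded q].
Proof.
move=> f2 g2.
have [p p_lim] := fps_limit (fun n => (inv_iter_cauchy n f2 g2).1).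
have [q q_lim] := fps_limit (fun n => (inv_iter_cauchy n f2 g2).2).
have p1 : order_ge 1 p by have := p_lim 0%N; rewrite subr0.
have q1 : order_ge 1 q by have := q_lim 0%N; rewrite subr0.
have subE (a b c : fps2 K) : (a - b) - (a - c) = - (b - c) by ring.
exists p, q; split => //.
- apply: eq_order => n; apply: (@order_ge_leq _ _ n.+2); first by rewrite !leqW.
  apply: (order_ge_sub_trans (p_lim n.+1)); rewrite subE.
  apply/order_geN/order_ge_subC.
  by have [? ?] := inv_iter_order n f2 g2; apply: comp_contract.
- apply: eq_order => n; apply: (@order_ge_leq _ _ n.+2); first by rewrite !leqW.
  apply: (order_ge_sub_trans (q_lim n.+1)); rewrite subE.
  apply/order_geN/order_ge_subC.
  by have [? ?] := inv_iter_order n f2 g2; apply: comp_contract.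
move=> fb gb; have [M [rho [M0 rho1 fM gM]]] := geom_bounded2 fb gb.
have rho0 := le_trans ler01 rho1.
have A0 : 0 <= 4 * rho by rewrite mulr_ge0 ?ler0n.
have B0 : 0 <= 64 * M * rho ^+ 2 by rewrite !mulr_ge0 ?ler0n ?exprn_ge0.
pose D := 1 + 4 * rho + 64 * M * rho ^+ 2; pose r := D^-1.
have D1 : 1 <= D by rewrite /D -addrA lerDl addr_ge0.
have D0 : 0 < D := lt_le_trans ltr01 D1.
have r0 : 0 < r by rewrite invr_gt0.
have small1 : 4 * rho * r <= 1.
  by rewrite ler_pdivrMr // mul1r /D addrAC lerDr addr_ge0.
have small2 : 64 * M * rho ^+ 2 * r <= 1.
  by rewrite ler_pdivrMr // mul1r /D lerDr addr_ge0.
have bnd (h : fps2 K) : (forall N, boxnorm r N h <= 2 * r) -> geom_bounded h.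
  move=> h_le; exists (2 * r), D; split => //.
    by rewrite mulr_ge0 ?ler0n // ltW.
  move=> i j; have iN : (i < (i + j).+1)%N by rewrite ltnS leq_addr.
  have jN : (j < (i + j).+1)%N by rewrite ltnS leq_addl.
  have := le_trans (boxnorm_coef (ltW r0) h iN jN) (h_le _).
  by rewrite exprVn ler_pdivrMr ?exprn_gt0.
have it N n := inv_iter_boxnorm N n f2 g2 M0 rho1 (ltW r0) small1 small2 fM gM.
split; apply: bnd => N.
  rewrite (@boxnorm_eq _ _ _ _ (inv_iter f g (N + N)).1); first by case: (it N (N + N)%N).
  exact: order_ge_leq (p_lim _).
rewrite (@boxnorm_eq _ _ _ _ (inv_iter f g (N + N)).2); first by case: (it N (N + N)%N).
exact: order_ge_leq (q_lim _).
Qed.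

(** The right inverse is again tangent to the identity and so has a right
    inverse (u, w); associativity of composition identifies (u, w) with
    (x + f, y + g), which makes the inverse two-sided. *)
Lemma inverse_map f g : order_ge 2 f -> order_ge 2 g ->
  exists p q : fps2 K,
  [/\ order_ge 1 p, order_ge 1 q,
      Defs.pair_eq (Defs.map_comp (fps_x + f, fps_y + g) (p, q)) (id_map K),
      Defs.pair_eq (Defs.map_comp (p, q) (fps_x + f, fps_y + g)) (id_map K) &
      geom_bounded f -> geom_bounded g -> geom_bounded p /\ geom_bounded q].
Proof.
move=> f2 g2; have [p [q [p1 q1 pE qE bnd]]] := right_inverse f2 g2.
pose f' := - (fps_comp f p q : fps2 K); pose g' := - (fps_comp g p q : fps2 K).
have f'2 : order_ge 2 f' by apply/order_geN/order_ge_comp.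
have g'2 : order_ge 2 g' by apply/order_geN/order_ge_comp.
have [u [w [u1 w1 uE wE _]]] := right_inverse f'2 g'2.
have rinv (h a b s t : fps2 K) : fps_comp a s t = b ->
    fps_comp (a + h) s t = b + fps_comp h s t by move=> <-; rewrite fps_compD.
have PQx : fps_comp (fps_x + f) p q = fps_x.
  by rewrite (rinv _ _ _ _ _ (fps_comp_x p1 q1)) {1}pE subrK.
have PQy : fps_comp (fps_y + g) p q = fps_y.
  by rewrite (rinv _ _ _ _ _ (fps_comp_y p1 q1)) {1}qE subrK.
have QSx : fps_comp p u w = fps_x.
  by rewrite pE -/f' (rinv _ _ _ _ _ (fps_comp_x u1 w1)) {1}uE subrK.
have QSy : fps_comp q u w = fps_y.
  by rewrite qE -/g' (rinv _ _ _ _ _ (fps_comp_y u1 w1)) {1}wE subrK.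
have SE (h : fps2 K) : fps_comp (fps_comp h p q) u w = h.
  by rewrite fps_compA // QSx QSy fps_comp_id.
have Sx : u = fps_x + f by rewrite -[RHS]SE PQx fps_comp_x.
have Sy : w = fps_y + g by rewrite -[RHS]SE PQy fps_comp_y.
exists p, q; split => //.
  by split; rewrite /= (PQx, PQy).
by split; rewrite /= -Sx -Sy (QSx, QSy).
Qed.

End InverseMap.

(** * Geometric bounds and convergence *)
Section Convergence.
Variables (R : realType) (K : numFieldType).
Hypothesis K_real_or_complex :
  K = (R : numFieldType) \/ K = (R[i] : numFieldType).
Implicit Types f : fps2 K.

(** A series of nonnegative complex numbers is the image of a real series, for
    which monotone convergence applies. *)
Lemma bounded_series_cvg (u : nat -> K) (B : K) :
  (forall n, 0 <= u n) -> (forall n, series u n <= B) -> cvgn (series u).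
Proof.
have real_case (v : nat -> R) (b : R) : (forall n, 0 <= v n) ->
    (forall n, series v n <= b) -> cvgn (series v).
  move=> v0 vb; apply: nondecreasing_is_cvgn.
    apply/nondecreasing_seqP => n; rewrite !seriesEnat /= big_nat_recr //=.
    by rewrite lerDl.
  by exists b => _ [n _ <-].
move: u B; case: K_real_or_complex => -> u B u0 uB; first exact: real_case uB.
pose v n := complex.Re (u n).
have uE n : u n = (v n)%:C%C by rewrite RRe_real // ger0_real.
have v0 n : 0 <= v n by rewrite -ler0c -uE.
have sE n : series u n = (series v n)%:C%C.
  rewrite !seriesEnat /= rmorph_sum; apply: eq_bigr => k _; exact: uE.
have vB n : series v n <= complex.Re B.
  by have := uB n; rewrite sE lecE => /andP[].
have /cvg_ex[l vl] := real_case v _ v0 vB.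
apply/cvg_ex; exists (l%:C%C); apply/cvgrPdist_lt => eps eps0.
have epsE : (complex.Re eps)%:C%C = eps by rewrite RRe_real // gtr0_real.
have eps0' : 0 < complex.Re eps by rewrite -ltcR epsE.
move/cvgrPdist_lt : vl => /(_ _ eps0'); apply: filterS => n.
rewrite sE -rmorphB normc_def /= expr0n addr0 sqrtr_sqr -epsE.
by rewrite ltcR.
Qed.

(** Cauchy's estimate: at the point (r/2, r/2) the terms of the convergent
    series are bounded. *)
Lemma convergent_geom_bounded f : convergent f -> geom_bounded f.
Proof.
case=> r r0 f_cvg; pose t := r / 2.
have t0 : 0 < t by rewrite divr_gt0 ?ltr0n.
have tr : `|t| < r by rewrite gtr0_norm // ltr_pdivrMr ?ltr0n // ltr_pMr // ltr1n.
set u := fun n : nat => \sum_(i < n.+1) `|f i (n - i)%N * t ^+ i * t ^+ (n - i)|.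
have u_cvg : cvgn (series u) := f_cvg t t tr tr.
have /cvg_seq_bounded : cvgn u.
  by apply/cvg_ex; exists 0; apply: cvg_series_cvg_0 u_cvg.
case=> M [Mreal uM]; pose B := `|M| + 1.
have B0 : 0 <= B by rewrite addr_ge0.
have MB : M < B by rewrite (le_lt_trans (real_ler_norm Mreal)) // ltrDl.
exists B, (1 + t^-1); split => //.
  by rewrite lerDl invr_ge0 ltW.
move=> i j; apply: (@le_trans _ _ (B * t^-1 ^+ (i + j))); last first.
  rewrite ler_wpM2l // lerXn2r // ?nnegrE ?addr_ge0 ?invr_ge0 ?(ltW t0) //.
  by rewrite lerDr.
rewrite exprVn ler_pdivlMr ?exprn_gt0 //.
have := uM B MB (i + j)%N I; rewrite /= ger0_norm; last by apply: sumr_ge0.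
apply: le_trans; rewrite /u.
have ilt : (i < (i + j).+1)%N by rewrite ltnS leq_addr.
rewrite (bigD1 (Ordinal ilt)) //= (addKn i j) -mulrA -exprD normrM.
rewrite (@ger0_norm _ (t ^+ _)) ?exprn_ge0 ?(ltW t0) // lerDl.
exact: sumr_ge0.
Qed.

Lemma geom_bounded_convergent f : geom_bounded f -> convergent f.
Proof.
move=> [M [rho [M0 rho1 fM]]]; have rho0 := lt_le_trans ltr01 rho1.
exists (4 * rho)^-1; first by rewrite invr_gt0 mulr_gt0 ?ltr0n.
move=> x y xr yr; apply: (@bounded_series_cvg _ (M * 2)).
  by move=> n; apply: sumr_ge0.
move=> n; rewrite seriesEnat /= big_mkord.
apply: (@le_trans _ _ (\sum_(k < n) M * 2^-1 ^+ k)); last first.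
  by rewrite -mulr_sumr ler_wpM2l ?sum_half.
apply: ler_sum => k _.
apply: (@le_trans _ _ (\sum_(i < k.+1) M * 4^-1 ^+ k)).
  apply: ler_sum => i _; have ik : (i <= k)%N by rewrite -ltnS.
  rewrite !normrM !normrX -mulrA.
  apply: (@le_trans _ _ (M * rho ^+ k * ((4 * rho)^-1 ^+ i * (4 * rho)^-1 ^+ (k - i)))).
    apply: ler_pM => //; rewrite ?mulr_ge0 ?exprn_ge0 //.
      by have := fM i (k - i)%N; rewrite subnKC.
    apply: ler_pM; rewrite ?exprn_ge0 // lerXn2r
      ?nnegrE ?invr_ge0 ?mulr_ge0 ?ler0n ?(ltW rho0) //; exact: ltW.
  rewrite -exprD subnKC // -mulrA -exprMn invfM mulrCA mulfV ?mulr1 //.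
  exact: lt0r_neq0.
rewrite sumr_const card_ord -mulrnAr ler_wpM2l // -[leLHS]mulr_natl.
have -> : 4^-1 = 2^-1 * 2^-1 :> K by field.
rewrite exprMn mulrA -[leRHS]mul1r ler_wpM2r ?exprn_ge0 ?invr_ge0 ?ler0n //.
by rewrite exprVn ler_pdivrMr ?exprn_gt0 ?ltr0n // mul1r le_exp2.
Qed.

End Convergence.

(** * Division by y + f and the linear Cauchy-Kovalevskaya theorem *)
Section Majorants.
Variable K : numFieldType.
Implicit Types a b c f g h p : fps2 K.

Lemma half_powers (rho C : K) k n : 0 <= rho -> 2 * rho <= C -> (k <= n)%N ->
  rho ^+ k * C ^+ (n - k) <= 2^-1 ^+ k * C ^+ n.
Proof.
move=> rho0 rhoC kn; have C0 : 0 <= C by apply: le_trans rhoC; rewrite mulr_ge0 ?ler0n.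
rewrite -{2}(subnKC kn) exprD mulrA ler_wpM2r ?exprn_ge0 // -exprMn.
rewrite lerXn2r ?nnegrE ?mulr_ge0 ?invr_ge0 ?ler0n //.
by rewrite mulrC ler_pdivlMr ?ltr0n // mulrC.
Qed.

(** Comparing the coefficients of x^i y^(j+1) gives
    h_ij = g_i(j+1) - (f h)_i(j+1), where the product only involves
    coefficients of h of total degree less than i + j because f has order
    two. *)
Lemma quotient_bounded f g h : order_ge 2 f ->
    geom_bounded f -> geom_bounded g -> g = (fps_y + f) * h ->
  geom_bounded h.
Proof.
move=> f2 fb gb gE; have [M [rho [M0 rho1 fM gM]]] := geom_bounded2 fb gb.
have rho0 := le_trans ler01 rho1.
have hE i j : h i j = g i j.+1 - (f * h) i j.+1.
  by rewrite gE mulrDl fpsD coef_fps_yM addrK.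
(* The bound C^(i+j+1) closes the induction: M rho comes from g, 16 M rho^2
   from the double geometric series, and 2 rho <= C makes its ratio 1/2. *)
pose C := M * rho + 16 * M * rho ^+ 2 + 2 * rho.
have P1 : 0 <= M * rho by rewrite mulr_ge0.
have P2 : 0 <= 16 * M * rho ^+ 2 by rewrite !mulr_ge0 ?exprn_ge0 ?ler0n.
have rhoC : 2 * rho <= C by rewrite /C lerDr addr_ge0.
have C1 : rho <= C by apply: le_trans rhoC; rewrite ler_peMl ?ler1n.
have C0 : 0 <= C := le_trans rho0 C1.
have bound n : forall i j, (i + j)%N = n -> `|h i j| <= C ^+ n.+1.
  elim/ltn_ind: n => n IH i j ijn; rewrite hE.
  apply: le_trans (ler_normB _ _) _.
  apply: (@le_trans _ _ (M * rho * C ^+ n + 4 * (4 * M * rho ^+ 2 * C ^+ n))).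
    apply: lerD.
      apply: le_trans (gM _ _) _; rewrite addnS ijn exprS mulrA ler_wpM2l //.
      by rewrite lerXn2r ?nnegrE.
    rewrite fps_coefM; apply: le_trans (ler_norm_sum _ _ _) _.
    apply: le_trans (ler_sum _ (fun k _ => ler_norm_sum _ _ _)) _.
    apply: (sum_half2 (c := fun k l => `|f k l * h (i - k)%N (j.+1 - l)%N|)).
      by rewrite !mulr_ge0 ?exprn_ge0 ?ler0n.
    move=> k l; rewrite !ltnS => ki lj; rewrite normrM.
    have [kl2|kl2] := ltnP (k + l) 2.
      by rewrite f2 // normr0 mul0r !mulr_ge0 ?exprn_ge0 ?invr_ge0 ?ler0n.
    have sE : ((i - k) + (j.+1 - l) + (k + l) = n.+1)%N.
      by rewrite addnACA !subnK // addnS ijn.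
    have sn : ((i - k) + (j.+1 - l) < n)%N.
      suff : ((i - k) + (j.+1 - l) + 2 <= n.+1)%N by rewrite addn2.
      by rewrite -sE leq_add2l.
    apply: (@le_trans _ _ (M * rho ^+ (k + l) * C ^+ ((i - k) + (j.+1 - l)).+1)).
      by apply: ler_pM => //; apply: IH.
    have -> : ((i - k) + (j.+1 - l)).+1 = (n.+2 - (k + l))%N.
      by rewrite -[LHS](addnK (k + l)%N) addSn sE.
    have [e klE] : exists e, (k + l = e.+2)%N.
      by exists (k + l - 2)%N; rewrite -addn2 subnK.
    have en : (e <= n)%N.
      suff : (e.+2 <= n.+2)%N by []. 
      by rewrite -klE leqW // -sE leq_addl.
    rewrite klE !subSS.
    have -> : M * rho ^+ e.+2 * C ^+ (n - e) =
        M * rho ^+ 2 * (rho ^+ e * C ^+ (n - e)) by rewrite !exprS; ring.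
    have -> : 4 * M * rho ^+ 2 * C ^+ n * 2^-1 ^+ e.+2 =
        M * rho ^+ 2 * (2^-1 ^+ e * C ^+ n) by rewrite !exprS; field.
    by rewrite ler_wpM2l ?mulr_ge0 ?exprn_ge0 // half_powers.
  have -> : M * rho * C ^+ n + 4 * (4 * M * rho ^+ 2 * C ^+ n) =
    (M * rho + 16 * M * rho ^+ 2) * C ^+ n by ring.
  by rewrite [leRHS]exprS ler_wpM2r ?exprn_ge0 // /C lerDl mulr_ge0 ?ler0n.
exists C, C; split => //; first exact: le_trans C1.
by move=> i j; rewrite -exprS; apply: bound.
Qed.

(** The right-hand side of the Cauchy problem f_x = a f + b f_y + c. *)
Definition transport_rhs a b c f : fps2 K := a * f + b * fps_dy f + c.

Lemma transport_rhs_local a b c f g i :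
    (forall k j, (k <= i)%N -> f k j = g k j) ->
  forall j, transport_rhs a b c f i j = transport_rhs a b c g i j.
Proof.
move=> fg j; rewrite /transport_rhs !fpsD !fps_coefM; congr (_ + _ + _).
  apply: eq_bigr => k _; apply: eq_bigr => l _.
  by rewrite fg // leq_subr.
apply: eq_bigr => k _; apply: eq_bigr => l _.
by rewrite /fps_dy fg // leq_subr.
Qed.

(** The equation determines the coefficients of x^(i+1) from those of x^0, ...,
    x^i; the iterate of rank n is correct up to x^n. *)
Fixpoint transport_iter a b c n : fps2 K :=
  if n is n'.+1 then fun i j =>
    if (i <= n')%N then transport_iter a b c n' i j
    else transport_rhs a b c (transport_iter a b c n') i.-1 j / i%:R
  else 0.

Lemma transport_solution a b c : exists f,
  (forall j, f 0%N j = 0) /\ fps_dx f = transport_rhs a b c f.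
Proof.
pose s := transport_iter a b c; pose f : fps2 K := fun i j => s i i j.
have stable i m j : s (i + m)%N i j = f i j.
  elim: m => [|m IH]; first by rewrite addn0.
  by rewrite addnS -IH /s /= leq_addr.
exists f; split => // ; apply: fps_ext => i j.
rewrite /fps_dx {1}/f {1}/s /= ltnn -[LHS]mulr_natr divfK ?pnatr_eq0 //.
apply: transport_rhs_local => k l ki; rewrite -(stable _ (i - k)%N) subnKC //.
Qed.

Lemma bin_sum_mono i j k l : (k <= i)%N -> (l <= j)%N ->
  ('C(k + l, k) <= 'C(i + j, i))%N.
Proof.
move=> ki lj; apply: (@leq_trans 'C(k + j, k)).
  by apply: leq_bin2l; rewrite leq_add2l.
rewrite -[X in 'C(_, X)](addnK j k) bin_sub ?leq_addl //.
rewrite -[X in (_ <= 'C(_, X))%N](addnK j i) bin_sub ?leq_addl //.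
by apply: leq_bin2l; rewrite leq_add2r.
Qed.

(** The majorant is C^i D^j binomial(i+j, i).  It absorbs the loss of one
    y-derivative exactly: both (j+1) binomial(i+j+1, i) and
    (i+1) binomial(i+j+1, i+1) equal (i+j+1) binomial(i+j, i), so the factor
    j+1 from the derivative is compensated by the factor i+1 that integration
    in x divides by. *)
Lemma transport_bounded a b c f :
    geom_bounded a -> geom_bounded b -> geom_bounded c ->
    (forall j, f 0%N j = 0) -> fps_dx f = transport_rhs a b c f ->
  geom_bounded f.
Proof.
move=> [Ma [ra [Ma0 ra1 aM']]] bb cb f0 fE.
have ab : geom_bounded a by exists Ma, ra.
have [M1 [rho1 [M10 rho11 aM1 bM1]]] := geom_bounded2 ab bb.
have [M2 [rho2 [M20 rho21 cM2 _]]] := geom_bounded2 cb cb.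
pose M := M1 + M2; pose rho := rho1 + rho2.
have M0 : 0 <= M by rewrite addr_ge0.
have rho10 := le_trans ler01 rho11; have rho20 := le_trans ler01 rho21.
have rho0 : 0 <= rho by rewrite addr_ge0.
have le1 n : M1 * rho1 ^+ n <= M * rho ^+ n.
  by rewrite ler_pM ?exprn_ge0 ?lerXn2r ?nnegrE ?lerDl.
have le2 n : M2 * rho2 ^+ n <= M * rho ^+ n.
  by rewrite ler_pM ?exprn_ge0 ?lerXn2r ?nnegrE ?lerDr.
have aM i j := le_trans (aM1 i j) (le1 (i + j)%N).
have bM i j := le_trans (bM1 i j) (le1 (i + j)%N).
have cM i j := le_trans (cM2 i j) (le2 (i + j)%N).
pose D := 2 * rho; pose C := 2 * rho + (M + 4 * (M * (1 + D))).
have D0 : 0 <= D by rewrite mulr_ge0 ?ler0n.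
have MD0 : 0 <= M * (1 + D) by rewrite mulr_ge0 ?addr_ge0.
have E0 : 0 <= M + 4 * (M * (1 + D)) by rewrite addr_ge0 ?mulr_ge0 ?ler0n ?addr_ge0.
have rhoC : 2 * rho <= C by rewrite /C lerDl.
have C0 : 0 <= C := le_trans D0 rhoC.
have bound i : forall j, `|f i j| <= C ^+ i * D ^+ j * 'C(i + j, i)%:R.
  elim/ltn_ind: i => -[|i] IH j.
    by rewrite f0 normr0 !mulr_ge0 ?exprn_ge0 ?ler0n.
  have i1 : 0 < i.+1%:R :> K by rewrite ltr0n.
  rewrite -(ler_pM2r i1) -{1}[i.+1%:R]normr_nat -normrM mulr_natr.
  have -> : f i.+1 j *+ i.+1 = transport_rhs a b c f i j by rewrite -fE.
  pose B : K := ((i + j).+1 * 'C(i + j, i))%N%:R.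
  have B0 : 0 <= B by rewrite ler0n.
  apply: (@le_trans _ _ ((M + 4 * (M * (1 + D))) * (C ^+ i * D ^+ j * B))).
    have CDB0 : 0 <= C ^+ i * D ^+ j * B by rewrite !mulr_ge0 ?exprn_ge0.
    rewrite /transport_rhs !fpsD mulrDl addrC.
    apply: le_trans (ler_normD _ _) _; apply: lerD.
      apply: le_trans (cM _ _) _; rewrite ler_wpM2l // exprD.
      apply: (@le_trans _ _ (C ^+ i * D ^+ j)).
        have rho_2rho : rho <= 2 * rho by rewrite ler_peMl ?ler1n.
        by rewrite ler_pM ?exprn_ge0 // lerXn2r ?nnegrE // (le_trans rho_2rho).
      by rewrite ler_peMr ?mulr_ge0 ?exprn_ge0 // ler1n muln_gt0 bin_gt0 leq_addr.
    rewrite !fps_coefM -big_split /= -mulrA.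
    apply: le_trans (ler_norm_sum _ _ _) _.
    under eq_bigr do rewrite -big_split /=.
    apply: le_trans (ler_sum _ (fun k _ => ler_norm_sum _ _ _)) _.
    apply: (sum_half2 (c := fun k l => `|a k l * f (i - k)%N (j - l)%N +
       b k l * fps_dy f (i - k)%N (j - l)%N|)); first exact: mulr_ge0.
    move=> k l; rewrite !ltnS => ki lj.
    pose m := (i - k)%N; pose n := (j - l)%N.
    pose Bmn : K := ((m + n).+1 * 'C(m + n, m))%N%:R.
    have BB : Bmn <= B.
      rewrite ler_nat leq_mul // ?bin_sum_mono ?leq_subr //.
      by rewrite ltnS leq_add ?leq_subr.
    have mi : (m < i.+1)%N by rewrite ltnS leq_subr.
    have fmn : `|f m n| <= C ^+ m * D ^+ n * Bmn.
      apply: le_trans (IH m mi n) _; rewrite ler_wpM2l ?mulr_ge0 ?exprn_ge0 //.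
      by rewrite ler_nat leq_pmull.
    have dfmn : `|fps_dy f m n| <= C ^+ m * D ^+ n * Bmn * D.
      rewrite /fps_dy normrMn -mulr_natr.
      have -> : C ^+ m * D ^+ n * Bmn * D =
          C ^+ m * D ^+ n.+1 * 'C(m + n.+1, m)%:R * n.+1%:R.
        have -> : Bmn = 'C(m + n.+1, m)%:R * n.+1%:R.
          rewrite -natrM /Bmn addnS (mul_bin_down (m + n).+1 m).
          by rewrite subSn ?leq_addr // addKn mulnC.
        by rewrite exprS; ring.
      by rewrite ler_wpM2r ?ler0n // IH.
    apply: (@le_trans _ _ (M * rho ^+ (k + l) * (C ^+ m * D ^+ n * Bmn * (1 + D)))).
      rewrite [leRHS]mulrA [leRHS]mulrDr mulr1 -[X in _ <= _ + X]mulrA.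
      apply: le_trans (ler_normD _ _) _.
      by rewrite !normrM; apply: lerD; apply: ler_pM.
    have hk := half_powers rho0 rhoC ki; have hl := half_powers rho0 (lexx D) lj.
    have -> : M * rho ^+ (k + l) * (C ^+ m * D ^+ n * Bmn * (1 + D)) =
        M * (1 + D) * ((rho ^+ k * C ^+ m) * (rho ^+ l * D ^+ n) * Bmn).
      by rewrite exprD; ring.
    have -> : M * (1 + D) * (C ^+ i * D ^+ j * B) * 2^-1 ^+ (k + l) =
        M * (1 + D) * ((2^-1 ^+ k * C ^+ i) * (2^-1 ^+ l * D ^+ j) * B).
      by rewrite exprD; ring.
    rewrite ler_wpM2l // ler_pM ?mulr_ge0 ?exprn_ge0 ?ler0n //.
    by rewrite ler_pM ?mulr_ge0 ?exprn_ge0.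
  have -> : C ^+ i.+1 * D ^+ j * 'C(i.+1 + j, i.+1)%:R * i.+1%:R =
      C * (C ^+ i * D ^+ j * B).
    have -> : B = 'C(i.+1 + j, i.+1)%:R * i.+1%:R.
      by rewrite -natrM /B (mul_bin_diag (i + j).+1 i) mulnC.
    by rewrite exprS; ring.
  by rewrite ler_wpM2r ?mulr_ge0 ?exprn_ge0 // /C lerDr.
exists 1, (2 * (1 + C + D)); split => //.
  by apply: mulr_ege1; rewrite ?ler1n // -addrA lerDl (addr_ge0 C0 D0).
move=> i j; apply: le_trans (bound i j) _; rewrite [leRHS]mul1r [leRHS]exprMn [leLHS]mulrC.
have CD0 : 0 <= 1 + C + D := addr_ge0 (addr_ge0 ler01 C0) D0.
rewrite ler_pM ?mulr_ge0 ?exprn_ge0 ?ler0n //.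
  rewrite -natrX ler_nat -[X in (_ <= X ^ _)%N]/(1 + 1)%N Pascal.
  have ilt : (i < (i + j).+1)%N by rewrite ltnS leq_addr.
  by rewrite (bigD1 (Ordinal ilt)) //= !exp1n !muln1 leq_addr.
rewrite exprD ler_pM ?exprn_ge0 // lerXn2r ?nnegrE //.
  by rewrite addrAC lerDr (addr_ge0 ler01 D0).
by rewrite lerDr (addr_ge0 ler01 C0).
Qed.

End Majorants.

(** * Formal linearization and convergent coordinates *)
Section Linearization.
Variable K : numFieldType.
Implicit Types (c : K) (f g h k p q u w : fps2 K).

Lemma lie_derivativeE (V : fps_pair K) p :
  lie_derivative V p = fps_dx p * V.1 + fps_dy p * V.2.
Proof. by []. Qed.

Lemma fps_dx_const c p : fps_dx (fps_const c * p) = fps_const c * fps_dx p.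
Proof.
by apply: fps_ext => i j; rewrite fps_constM /fps_dx fps_constM mulrnAr.
Qed.

Lemma fps_dy_const c p : fps_dy (fps_const c * p) = fps_const c * fps_dy p.
Proof.
by apply: fps_ext => i j; rewrite fps_constM /fps_dy fps_constM mulrnAr.
Qed.

Lemma lie_derivative_comb (V : fps_pair K) (s t : K) p q :
  lie_derivative V (fps_const s * p + fps_const t * q) =
  fps_const s * lie_derivative V p + fps_const t * lie_derivative V q :> fps2 K.
Proof.
rewrite !lie_derivativeE fps_dxD fps_dyD !fps_dx_const !fps_dy_const; ring.
Qed.

Lemma coefM_deg1 p q i j : (i + j = 1)%N -> q 0%N 0%N = 0 ->
  (p * q) i j = p 0%N 0%N * q i j.
Proof.
move=> ij q0.
have [[-> ->]|[-> ->]] : (i = 0 /\ j = 1 \/ i = 1 /\ j = 0)%N.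
- by case: i ij => [|[|i]] //; case: j => [|[|j]] //; [left|right].
- rewrite fps_coefM big_ord1 big_ord_recl big_ord1 /=.
  by rewrite subn0 subSS subnn q0 mulr0 addr0.
- rewrite fps_coefM big_ord_recl !big_ord1 /=.
  by rewrite subn0 subSS subnn q0 mulr0 addr0.
Qed.

Lemma coef_comp_deg1 f p q i j : (i + j = 1)%N ->
    p 0%N 0%N = 0 -> q 0%N 0%N = 0 ->
  (fps_comp f p q : fps2 K) i j =
    f 1%N 0%N * p i j + f 0%N 1%N * q i j.
Proof.
move=> ij p0 q0; rewrite fps_compE ij !big_ord_recl !big_ord0 !addr0 /=.
rewrite -[bump 0 0]/1%N !expr0 !expr1 mul1r mulr1 [X in f 1%N 1%N * X]coefM_deg1 //.
have -> : (1 : fps2 K) i j = 0 by case: i j ij => [|[|i]] [|[|j]].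
by rewrite p0 mul0r !mulr0 addr0 add0r addrC mul1r.
Qed.

Section Field.
Variables f g : fps2 K.
Hypotheses (f2 : order_ge 2 f) (g2 : order_ge 2 g).
Let V : fps_pair K := (fps_add fps_y f, g).
Let p : fps2 K := fps_y + f.
Let D h : fps2 K := lie_derivative V h.

Let DE h : D h = fps_dx h * p + fps_dy h * g. Proof. by []. Qed.

Let p00 : p 0%N 0%N = 0. Proof. by rewrite /p fpsD f2 // addr0. Qed.
Let p10 : p 1%N 0%N = 0. Proof. by rewrite /p fpsD f2 // addr0. Qed.
Let p01 : p 0%N 1%N = 1. Proof. by rewrite /p fpsD f2 // addr0. Qed.

Let D10 h : D h 1%N 0%N = 0.
Proof. by rewrite DE fpsD !coefM_deg1 ?g2 // p10 !mulr0 addr0. Qed.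
Let D01 h : D h 0%N 1%N = h 1%N 0%N.
Proof. by rewrite DE fpsD !coefM_deg1 ?g2 // p01 mulr1 mulr0 addr0. Qed.

(** If P linearizes v to the linear field with matrix A, then v(v(P)) = A^2 P.
    The linear part of v is nilpotent, so that v(v(h)) has no linear terms for
    any h, and A^2 = 0 because the components of P have independent linear
    parts. *)
Lemma nilpotent_coordinate : linearizable formal V ->
  exists X : fps2 K, X 1%N 0%N != 0 /\ D (D X) = 0.
Proof.
move=> [[P1 P2] [[W1 W2] [[[/= P10 P20] _ [[Q1 Q2] [[/= Q10 Q20] _ PQ _]]]]]].
case=> /= W1lin W2lin [/= VP1 VP2].
have P1o := order_ge1 P10; have P2o := order_ge1 P20.
have DP1 : D P1 = fps_const (W1 1%N 0%N) * P1 + fps_const (W1 0%N 1%N) * P2.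
  by rewrite -fps_comp_linear //; apply: fps_ext.
have DP2 : D P2 = fps_const (W2 1%N 0%N) * P1 + fps_const (W2 0%N 1%N) * P2.
  by rewrite -fps_comp_linear //; apply: fps_ext.
have PQE i j : (i + j = 1)%N ->
    P1 1%N 0%N * Q1 i j + P1 0%N 1%N * Q2 i j = (fps_x : fps2 K) i j /\
    P2 1%N 0%N * Q1 i j + P2 0%N 1%N * Q2 i j = (fps_y : fps2 K) i j.
  by move=> ij; case: PQ => /= PQ1 PQ2; rewrite -!coef_comp_deg1 // PQ1 PQ2.
have [/= e11 e21] := PQE 1%N 0%N erefl; have [/= e12 e22] := PQE 0%N 1%N erefl.
rewrite /fps_x /fps_y /= ?mulr1n ?mulr0n in e11 e21 e12 e22.
have indep s t : (fps_const s * P1 + fps_const t * P2 : fps2 K) 1%N 0%N = 0 ->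
    (fps_const s * P1 + fps_const t * P2 : fps2 K) 0%N 1%N = 0 ->
    fps_const s * P1 + fps_const t * P2 = 0.
  rewrite !fpsD !fps_constM => x0 y0.
  have -> : s = 0.
    transitivity (s * (P1 1%N 0%N * Q1 1%N 0%N + P1 0%N 1%N * Q2 1%N 0%N) +
      t * (P2 1%N 0%N * Q1 1%N 0%N + P2 0%N 1%N * Q2 1%N 0%N)).
      by rewrite e11 e21 mulr1 mulr0 addr0.
    transitivity ((s * P1 1%N 0%N + t * P2 1%N 0%N) * Q1 1%N 0%N +
      (s * P1 0%N 1%N + t * P2 0%N 1%N) * Q2 1%N 0%N); first by ring.
    by rewrite x0 y0 !mul0r addr0.
  have -> : t = 0.
    transitivity (s * (P1 1%N 0%N * Q1 0%N 1%N + P1 0%N 1%N * Q2 0%N 1%N) +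
      t * (P2 1%N 0%N * Q1 0%N 1%N + P2 0%N 1%N * Q2 0%N 1%N)).
      by rewrite e12 e22 mulr1 mulr0 add0r.
    transitivity ((s * P1 1%N 0%N + t * P2 1%N 0%N) * Q1 0%N 1%N +
      (s * P1 0%N 1%N + t * P2 0%N 1%N) * Q2 0%N 1%N); first by ring.
    by rewrite x0 y0 !mul0r addr0.
  by rewrite fps_const0 !mul0r addr0.
have nil h (s t : K) : D h = fps_const s * P1 + fps_const t * P2 -> D (D h) = 0.
  move=> Dh.
  have DDh : D (D h) = fps_const (s * W1 1%N 0%N + t * W2 1%N 0%N) * P1 +
      fps_const (s * W1 0%N 1%N + t * W2 0%N 1%N) * P2.
    rewrite [in LHS]Dh [LHS]lie_derivative_comb -/(D P1) -/(D P2) DP1 DP2.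
    apply: fps_ext => i j.
    by rewrite !(fpsD, fps_constM); ring.
  by rewrite DDh; apply: indep; rewrite -DDh ?D10 // D01 D10.
have [P1x|P1x] := eqVneq (P1 1%N 0%N) 0; last by exists P1; split => //; apply: nil DP1.
have [P2x|P2x] := eqVneq (P2 1%N 0%N) 0; last by exists P2; split => //; apply: nil DP2.
move: e11 e21 e22; rewrite P1x P2x !mul0r !add0r => e11 /eqP e21 e22.
move: e21; rewrite mulf_eq0 => /orP[] /eqP e0.
  by move: e22; rewrite e0 mul0r => /esym/eqP; rewrite oner_eq0.
by move: e11; rewrite e0 mulr0 => /esym/eqP; rewrite oner_eq0.
Qed.

(** With Y = v(X), the relation p Y_x + g Y_y = 0 is solved for g by inverting
    Y_y, which gives h = - Y_x / Y_y and w(Y) = 0.  As Y = p U with U = w(X) a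
    unit, w(p) U + p w(U) = 0 is then solved for w(p). *)
Lemma formal_factorization X : X 1%N 0%N != 0 -> D (D X) = 0 ->
  exists h k : fps2 K,
    [/\ g = p * h, h 0%N 0%N = 0 & fps_dx p + h * fps_dy p = p * k].
Proof.
move=> X10 DDX; pose Y := D X.
have DY : fps_dx Y * p + fps_dy Y * g = 0 by rewrite -DE.
have [|v Yv] := @fps_inverse K (fps_dy Y); first by rewrite /fps_dy mulr1n /Y D01.
pose h := - (fps_dx Y * v).
have gE : g = p * h.
  transitivity (fps_dy Y * v * g); first by rewrite Yv mul1r.
  have -> : fps_dy Y * v * g = (fps_dx Y * p + fps_dy Y * g) * v + p * h.
    by rewrite /h; ring.
  by rewrite DY mul0r add0r.
have h00 : h 0%N 0%N = 0.
  by rewrite /h fpsN fps_coefM00 {1}/fps_dx /Y D10 mul0rn mul0r oppr0.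
pose U := fps_dx X + h * fps_dy X.
have YE : Y = p * U.
  by rewrite /Y DE [in LHS]gE /U; ring.
have [|z Uz] := @fps_inverse K U.
  by rewrite /U fpsD fps_coefM00 h00 mul0r addr0 /fps_dx mulr1n.
exists h, (- ((fps_dx U + h * fps_dy U) * z)); split => //.
have wY : fps_dx Y + h * fps_dy Y = 0.
  have -> : fps_dx Y + h * fps_dy Y = fps_dx Y * (1 - fps_dy Y * v).
    by rewrite /h; ring.
  by rewrite Yv subrr mulr0.
have wpU : (fps_dx p + h * fps_dy p) * U + p * (fps_dx U + h * fps_dy U) = 0.
  by rewrite -wY YE fps_dxM fps_dyM; ring.
rewrite -[LHS]mulr1 -Uz mulrA.
rewrite -[X in X * z](addrK (p * (fps_dx U + h * fps_dy U))) wpU.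
by ring.
Qed.

(** The unknown U = 1 + u is replaced by u so that both Cauchy problems have
    zero data on x = 0. *)
Lemma convergent_coordinates h k : geom_bounded f -> geom_bounded g ->
    g = p * h -> h 0%N 0%N = 0 -> fps_dx p + h * fps_dy p = p * k ->
  exists X Y : fps2 K,
  [/\ geom_bounded X, geom_bounded Y, D X = Y, D Y = 0 &
      order_ge 2 (X - fps_x) /\ order_ge 2 (Y - fps_y)].
Proof.
move=> fb gb gE h00 wp.
have pb : geom_bounded p := geom_boundedD (geom_bounded_y K) fb.
have hb : geom_bounded h := quotient_bounded f2 fb gb gE.
have kb : geom_bounded k.
  apply: (quotient_bounded f2 fb _ wp) => //.
  apply: geom_boundedD; first exact: geom_bounded_dx.
  by apply: geom_boundedM => //; apply: geom_bounded_dy.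
have [u [u0 uE]] := transport_solution (- k) (- h) (- k).
have ub : geom_bounded u.
  by apply: transport_bounded u0 uE; apply: geom_boundedN.
pose U := 1 + u.
have Ub : geom_bounded U by apply: geom_boundedD => //; apply: geom_bounded1.
have wU : fps_dx U + h * fps_dy U = - (k * U).
  by rewrite /U fps_dxD fps_dyD fps_dx1 fps_dy1 uE /transport_rhs; ring.
have [X [X0 XE]] := transport_solution 0 (- h) U.
have Xb : geom_bounded X.
  apply: transport_bounded X0 XE => //; last exact: geom_boundedN.
  by apply: (@geom_bounded_finite _ _ 0).
have wX : fps_dx X + h * fps_dy X = U by rewrite XE /transport_rhs; ring.
have Dw q : D q = p * (fps_dx q + h * fps_dy q) by rewrite DE [in LHS]gE; ring.
have U00 : U 0%N 0%N = 1 by rewrite /U fpsD u0 addr0.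
exists X, (p * U); split => //; first exact: geom_boundedM.
- by rewrite Dw wX.
- rewrite Dw fps_dxM fps_dyM.
  have -> : fps_dx p * U + p * fps_dx U + h * (fps_dy p * U + p * fps_dy U) =
    (fps_dx p + h * fps_dy p) * U + p * (fps_dx U + h * fps_dy U) by ring.
  by rewrite wp wU; ring.
have X10 : X 1%N 0%N = 1.
  rewrite -[LHS]mulr1n -[LHS]/(fps_dx X 0%N 0%N) XE /transport_rhs !fpsD.
  by rewrite !fps_coefM00 fpsN h00 oppr0 !mul0r !add0r.
have deg2 q : q 0%N 0%N = 0 -> q 1%N 0%N = 0 -> q 0%N 1%N = 0 -> order_ge 2 q.
  by move=> q00 q10 q01 [|[|i]] [|[|j]].
split; apply: deg2; rewrite fpsB.
- by rewrite X0 subrr.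
- by rewrite X10 subrr.
- by rewrite X0 subrr.
- by rewrite fps_coefM00 p00 mul0r subrr.
- by rewrite mulrC coefM_deg1 // p10 mulr0 subrr.
- by rewrite mulrC coefM_deg1 // p01 U00 mulr1 subrr.
Qed.

End Field.

End Linearization.

Theorem corollary2p3 (R : realType) (K : numFieldType)
    (K_real_or_complex :
      K = (R : numFieldType) \/ K = (R[i] : numFieldType))
    (f g : fps2 K)
    (f_cvg : convergent f) (g_cvg : convergent g)
    (f_order : order_ge 2 f) (g_order : order_ge 2 g) :
  linearizable convergent (fps_add fps_y f, g) <->
  linearizable formal (fps_add fps_y f, g).
Proof.
split=> [[P [W [[P0 _ [Q [Q0 _ PQ QP]]] W_lin PVW]]]|].
  by exists P, W; split => //; split => //; exists Q.
have fb := convergent_geom_bounded f_cvg; have gb := convergent_geom_bounded g_cvg.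
move=> /(nilpotent_coordinate f_order g_order)[X0 [X0x X0nil]].
have [h [k [gE h00 wp]]] := formal_factorization f_order g_order X0x X0nil.
have [X [Y [Xb Yb DX DY [Xid Yid]]]] :=
  convergent_coordinates f_order fb gb gE h00 wp.
have [p [q [p1 q1 PQ QP inv_b]]] := inverse_map Xid Yid.
have XE : fps_x + (X - fps_x) = X by rewrite addrC subrK.
have YE : fps_y + (Y - fps_y) = Y by rewrite addrC subrK.
rewrite XE YE in PQ QP.
have [pb qb] : geom_bounded p /\ geom_bounded q.
  apply: inv_b; apply: geom_boundedD => //; apply: geom_boundedN.
    exact: geom_bounded_x.
  exact: geom_bounded_y.
have cvg := geom_bounded_convergent K_real_or_complex.
have X00 : X 0%N 0%N = 0 by rewrite -XE fpsD Xid // addr0.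
have Y00 : Y 0%N 0%N = 0 by rewrite -YE fpsD Yid // addr0.
exists (X, Y), (fps_y, 0 : fps2 K); split.
- split; [by []|by split; apply: cvg|exists (p, q); split => //].
    by split; [apply: p1|apply: q1].
  by split; apply: cvg.
- by split; [apply: linear_fps_y|].
- have X1 := order_ge1 X00; have Y1 := order_ge1 Y00.
  by split => i j /=; rewrite ?fps_comp_y ?fps_comp0 ?DX // DY.
Qed.
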